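(* Let $G$ be a finite undirected graph and consider an undirected discrete graphical model for $G$. The UMVUE and the MLE of the vector of expected counts in this model coincide (as functions of the vector of sufficient statistics $b\in\mathbb{N}A$) if and only if the model is a decomposable graphical model. Moreover, in that case the MLE is rational, i.e. each component of the MLE of the expected counts is given by a rational function of the observed counts.
   Context: Notation: $\mathbb{N}=\{0,1,2,\ldots\}$, $\mathbb{N}A=\{Av:v\in\mathbb{N}^m\}$. Undirected discrete graphical model for $G=(V,E)$: each vertex $v\in V$ carries a discrete variable with a finite set $I_v$ of states ($|I_v|\ge 2$); the state space is $I=\prod_{v\in V}I_v$, $m=|I|$. For $j\in I$ and $C\subseteq V$, $j_C\in\prod_{v\in C}I_v$ is the restriction of $j$. The matrix $A$ has columns indexed by $j\in I$ and rows indexed by pairs $(C,i_C)$ with $C$ a clique (maximal complete subset) of $G$ and $i_C\in\prod_{v\in C}I_v$; the entry in row $(C,i_C)$ and column $j$ is $1$ if $j_C=i_C$ and $0$ otherwise. The sufficient statistics of counts $u\in\mathbb{N}^I$ are $b=Au$, i.e. the clique marginal counts. The model is the log-linear model $\mathcal{M}_A=\mathrm{cl}\{p\in\mathrm{int}(\Delta_{m-1}):\log p\in\mathrm{rowspan}(A)\}$, where $\Delta_{m-1}\subset\mathbb{R}^m$ is the standard probability simplex (the log-affine model with $x=(1,\ldots,1)$). Decomposable: the model is a decomposable graphical model if $G$ is decomposable, i.e. $G$ is complete, or $V$ is a disjoint union $V=V_1\cup V_2\cup S$ with $V_1,V_2\ne\emptyset$, $S$ complete (possibly empty), $S$ separating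 $V_1$ from $V_2$, and the induced subgraphs on $V_1\cup S$ and $V_2\cup S$ both decomposable (equivalently, $G$ is chordal). Sampling: $U$ is multinomial with total count $n$ and probability vector $p\in\mathcal{M}_A$; the vector of expected counts is $\mu=\mathbf{E}U=np$; $n$ is determined by $b=AU$. The UMVUE $\tilde\mu$ is the estimator whose components are unbiased for $\mu_j$ with uniformly minimum variance among unbiased estimators. The MLE is $\hat\mu=n\hat p$, where $\hat p$ is the (unique) maximizer over $p\in\mathcal{M}_A$ of the likelihood $\prod_j p_j^{u_j}$; it depends on $u$ only through $b=Au$. For $n=0$ both are $0$. *)

(* Defs.v *)
From HB Require Import structures.
From mathcomp Require Import all_boot all_order all_algebra.
From mathcomp Require Import boolp classical_sets reals topology normedtype exp.
(* The notations of mpoly clash with those of MathComp-Analysis. *)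
From mathcomp Require Import -(notations) mpoly.

Set Implicit Arguments.
Unset Strict Implicit.
Unset Printing Implicit Defensive.

Import Order.TTheory GRing.Theory Num.Theory.
Import numFieldNormedType.Exports.

Local Open Scope ring_scope.

Section Graph.
Context (V : finType) (e : rel V).
Implicit Types W : {set V}.

Definition complete_set W : bool :=
  [forall x in W, forall y in W, (x != y) ==> e x y].

Definition is_clique W : bool := maxset complete_set W.

(* Every walk from V1 to V2 inside the subgraph induced on W meets S. *)
Definition separates (W V1 V2 S : {set V}) : Prop :=
  forall (x : V) (s : seq V),
    x \in V1 -> path e x s -> all (mem W) s -> last x s \in V2 ->
    has (mem S) (x :: s).

(* decomposable W : the subgraph induced on W is decomposable. *)
Inductive decomposable : {set V} -> Prop :=
| decomposable_complete W : complete_set W -> decomposable W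
| decomposable_split (W V1 V2 S : {set V}) :
    W = V1 :|: V2 :|: S ->
    [disjoint V1 & V2] -> [disjoint V1 & S] -> [disjoint V2 & S] ->
    V1 != finset.set0 -> V2 != finset.set0 ->
    complete_set S -> separates W V1 V2 S ->
    decomposable (V1 :|: S) -> decomposable (V2 :|: S) ->
    decomposable W.

End Graph.

Section Model.
Context (V : finType) (e : rel V) (I : V -> finType).

Definition state : finType := {dffun forall v : V, I v}.

Definition marginal_state (C : {set V}) : finType :=
  {dffun forall v : {v : V | v \in C}, I (val v)}.

Definition restrict_state (C : {set V}) (j : state) : marginal_state C :=
  [ffun v : {v : V | v \in C} => j (val v)].

(* Row indices (C, i_C) of the 0-1 matrix A = design, C ranging over cliques. *)
Definition marginal_cell : finType :=
  {C : {C : {set V} | is_clique e C} & marginal_state (val C)}.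

Definition design (r : marginal_cell) (j : state) : nat :=
  restrict_state (val (tag r)) j == tagged r.

Definition counts := {ffun state -> nat}.

Definition total_count (u : counts) : nat := (\sum_j u j)%N.

Definition suffstat (u : counts) : {ffun marginal_cell -> nat} :=
  [ffun r => (\sum_j design r j * u j)%N].

Local Open Scope classical_set_scope.

Section Statistics.
Context (R : realType).

(* {ptws state -> R} carries the product topology of R^m, m = #|state|. *)
Definition open_model : set {ptws state -> R} :=
  [set p | [/\ forall j, 0 < p j, \sum_j p j = 1 &
     exists theta : marginal_cell -> R,
       forall j, ln (p j) = \sum_r theta r * (design r j)%:R]].

Definition model : set {ptws state -> R} := closure open_model.

Definition multinomial_pmf (n : nat) (p : state -> R) (u : counts) : R :=
  n`!%:R / (\prod_j (u j)`!%:R) * \prod_j p j ^+ u j.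

(* A vector of counts of total n has all its entries in 'I_n.+1. *)
Definition to_counts (n : nat) (w : {ffun state -> 'I_n.+1}) : counts :=
  [ffun j => w j : nat].

Definition expectation (n : nat) (p : state -> R) (f : counts -> R) : R :=
  \sum_(w : {ffun state -> 'I_n.+1} | total_count (to_counts w) == n)
     multinomial_pmf n p (to_counts w) * f (to_counts w).

Definition variance (n : nat) (p : state -> R) (f : counts -> R) : R :=
  expectation n p (fun u => (f u - expectation n p f) ^+ 2).

Definition unbiased (n : nat) (j : state) (f : counts -> R) : Prop :=
  forall p : state -> R, model p -> expectation n p f = n%:R * p j.

(* The competing estimators f may depend on the full vector of counts. *)
Definition is_umvue (T : {ffun marginal_cell -> nat} -> state -> R) : Prop :=
  forall (n : nat) (j : state),
    unbiased n j (fun u => T (suffstat u) j) /\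
    forall f : counts -> R, unbiased n j f ->
      forall p : state -> R, model p ->
        variance n p (fun u => T (suffstat u) j) <= variance n p f.

Definition likelihood (u : counts) (p : state -> R) : R :=
  \prod_j p j ^+ u j.

Definition maximizes_likelihood (u : counts) (p : state -> R) : Prop :=
  model p /\
  forall q : state -> R, model q -> likelihood u q <= likelihood u p.

(* When u = 0 every p in the model is a maximizer and the value is 0. *)
Definition is_mle (M : {ffun marginal_cell -> nat} -> state -> R) : Prop :=
  forall u : counts, exists2 p : state -> R,
    maximizes_likelihood u p &
    forall j, M (suffstat u) j = (total_count u)%:R * p j.

Definition eval_at (u : counts) (P : mpoly #|state| R) : R :=
  meval (fun i => (u (enum_val i))%:R) P.

(* The denominator may vanish only where some count is zero; nothing relies
   on the convention x / 0 = 0. *)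
Definition rational_in_counts (f : counts -> R) : Prop :=
  exists P Q : mpoly #|state| R,
    (forall u : counts, (forall j, (0 < u j)%N) -> eval_at u Q != 0) /\
    (forall u : counts, eval_at u Q != 0 -> f u = eval_at u P / eval_at u Q).

End Statistics.
End Model.

(* Main.v *)
(* UMVUE.  By independence of characters, unbiasedness alone forces T(b)_j to
   be the average of u_j over the tables u with A u = b, weighted by
   1 / \prod_k u_k!.

   Nondecomposable graphs.  Such a graph has an edge a - s and a path from a
   neighbour of a to a neighbour of s with no vertex adjacent to both a and s.
   Letting the states of a, of s and of the whole path vary over two levels
   embeds the 2 x 2 x 2 model without three-way interaction.  For the datum
   2 e_000 + e_011 + e_101 + e_110 the only other table with the same margins
   is e_000 + e_111 + e_001 + e_010 + e_100, so the UMVUE is (4/3 at 000, 1/3 at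
   the other even cells, 2/3 at the odd cells).  It violates the equation
   p_000 p_011 p_101 p_110 = p_111 p_001 p_010 p_100, which holds on the closed
   model and hence for the MLE.

   Decomposable graphs.  Along a decomposition put m_W = m_1 m_2 / b_S.  The
   sum Z(b) of 1 / \prod_k u_k! over the tables with margins b satisfies
   n Z(b) = \sum_j Z(b - a_j), and the product of the factorials of separator
   margins over those of clique margins satisfies the same recursion, because
   it gets multiplied by m_j(b) when b becomes b - a_j and \sum_j m_j(b) = n.
   So T = m.  On the other hand m / n is a limit of points of the open model
   with the right margins, so the binomial equations of the model turn the
   likelihood into p^m and Gibbs' inequality shows that m / n is the only
   maximizer. *)

Require Import Defs.
From mathcomp Require Import all_boot all_order all_algebra.
From mathcomp Require Import boolp classical_sets functions reals topology.
From mathcomp Require Import normedtype sequences realfun exp.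
From mathcomp Require Import ring lra zify.
From mathcomp Require mpoly.

Set Implicit Arguments.
Unset Strict Implicit.
Unset Printing Implicit Defensive.

Import Order.TTheory GRing.Theory Num.Theory.
Import numFieldNormedType.Exports.

(** * Nondecomposable graphs *)

Section Obstruction.
Context (V : finType) (e : rel V).
Hypothesis e_sym : symmetric e.
Implicit Types (W C : {set V}).

Lemma complete_setP W :
  reflect {in W &, forall x y, x != y -> e x y} (complete_set e W).
Proof.
apply: (iffP forall_inP) => h x.
  by move=> y xW yW xy; have /forall_inP/(_ y yW)/implyP/(_ xy) := h x xW.
by move=> xW; apply/forall_inP => y yW; apply/implyP => xy; apply: h.
Qed.

Lemma complete_setS W C : C \subset W -> complete_set e W -> complete_set e C.
Proof.
move=> /fintype.subsetP CW /complete_setP h; apply/complete_setP => x y.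
by move=> /CW xW /CW yW; exact: h.
Qed.

Lemma complete_set0 : complete_set e finset.set0.
Proof. by apply/complete_setP => x y; rewrite inE. Qed.

Lemma complete_edge x y : e x y -> complete_set e [set x; y].
Proof.
move=> exy; apply/complete_setP => a b; rewrite !inE.
by move=> /orP[] /eqP -> /orP[] /eqP ->; rewrite ?eqxx // e_sym.
Qed.

Lemma complete_set_clique C :
  complete_set e C -> exists2 K : {set V}, is_clique e K & C \subset K.
Proof. by move=> hC; have [K] := maxset_exists hC; exists K. Qed.

(* Contracting [t :: D] to a point turns [a], [s] and that point into a
   triangle which lies in no clique. *)
Definition chordless (a s t : V) (D : seq V) : Prop :=
  [/\ path e t D, e a s, e a t, e (last t D) s &
      {in t :: D, forall v, [/\ v != a, v != s & ~~ (e a v && e s v)]}].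

Lemma path_within (X : {set V}) x p :
  path [rel x y | [&& e x y, x \in X & y \in X]] x p ->
  x \in X -> {subset x :: p <= X}.
Proof.
elim: p x => [|y p IH] x /=; first by move=> _ xX z; rewrite inE => /eqP ->.
case/andP => /and3P[_ _ yX] hp xX z; rewrite inE => /orP[/eqP -> //|].
exact: IH.
Qed.

(* For [a], [b] nonadjacent, take the component [B] of [b] off the closed
   neighbourhood of [a]; then [S], the neighbourhood of [B], consists of
   neighbours of [a]. *)
Lemma decomposable_or_chordless W :
  decomposable e W \/ exists a s t D, chordless a s t D.
Proof.
have [n] := ubnP #|W|; elim: n W => // n IH W ltWn.
have [cW|] := boolP (complete_set e W); first by left; left.
rewrite negb_forall => /existsP[a]; rewrite negb_imply => /andP[aW].
rewrite negb_forall => /existsP[b]; rewrite !negb_imply.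
case/and3P=> bW ab neab.
pose X := [set v in W | (v != a) && ~~ e a v].
pose er := [rel x y | [&& e x y, x \in X & y \in X]].
have er_sym : connect_sym er.
  apply: sym_connect_sym => x y /=.
  by rewrite e_sym; congr andb; rewrite andbC.
have bX : b \in X by rewrite inE bW eq_sym ab.
pose B := [set v | connect er b v].
have BX v : v \in B -> v \in X.
  rewrite inE => /connectP[p hp ->].
  by apply: (path_within hp bX); rewrite mem_last.
have XW v : v \in X -> v \in W by rewrite inE => /andP[].
have aX : a \notin X by rewrite inE eqxx andbF.
pose S := [set v in W | (v \notin B) && [exists w in B, e w v]].
have BS w v : w \in B -> v \in W -> e w v -> v \notin B -> v \in S.
  by move=> wB vW ewv vB; rewrite inE vW vB; apply/exists_inP; exists w.
have aS : a \notin S.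
  rewrite inE aW /= negb_and; apply/orP; right; apply/exists_inP => -[w wB].
  by rewrite e_sym; move/BX: wB; rewrite inE => /and3P[_ _ /negbTE ->].
(* A vertex of [S] not adjacent to [a] would lie in [X], hence in the component [B], which [S]
   avoids. *)
have Sa v : v \in S -> e a v.
  move=> vS; apply: contraNT aS => nav.
  move: vS; rewrite inE => /and3P[vW vB /exists_inP[w wB ewv]].
  have [<-//|va] := eqVneq v a; first by apply: BS vW ewv vB.
  have vX : v \in X by rewrite inE vW va.
  case/negP: vB; rewrite inE; have := wB; rewrite inE => /connect_trans; apply.
  by apply: connect1; rewrite /= ewv vX (BX _ wB).
have [cS|] := boolP (complete_set e S).
  pose V1 := W :\: (B :|: S).
  have dBS : [disjoint B & S].
    by apply/pred0P => v /=; rewrite !inE; case: (connect er b v); rewrite ?andbF.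
  (* The induction applies because [b] is missing from [V1 :|: S] and, below, [a] is missing from
     [B :|: S]. *)
  have ltV1 : #|V1 :|: S| < n.
    rewrite -ltnS; apply: leq_trans ltWn; rewrite ltnS; apply: proper_card.
    apply/properP; split; last first.
      exists b => //; rewrite !inE connect0 /=.
      by rewrite andbF.
    apply/fintype.subsetP => v; rewrite !inE => /orP[/andP[]//|/andP[]//].
  have ltB : #|B :|: S| < n.
    rewrite -ltnS; apply: leq_trans ltWn; rewrite ltnS; apply: proper_card.
    apply/properP; split; last first.
      exists a => //; rewrite finset.in_setU negb_or aS andbT.
      by apply: contra aX; apply: BX.
    apply/fintype.subsetP => v; rewrite finset.in_setU => /orP[/BX/XW//|].
    by rewrite inE => /andP[].
  have [d1|//] := IH _ ltV1; last by right.
  have [d2|//] := IH _ ltB; last by right.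
  left; apply: (@decomposable_split _ _ W V1 B S) => //.
  - apply/setP => v; rewrite !inE; case vW: (v \in W) => /=.
      by case: (connect er b v) => //=; case: [exists w in B, e w v].
    rewrite andbF !orFb orbF; apply/esym/negbTE; apply: contraFN vW => vB.
    by apply/XW/BX; rewrite inE.
  - by apply/pred0P => v /=; rewrite !inE; case: (connect er b v); rewrite ?andbF.
  - apply/pred0P => v /=; rewrite finset.in_setD finset.in_setU negb_or.
    by case: (v \in S); rewrite ?andbF.
  - apply/finset.set0Pn; exists a; rewrite finset.in_setD finset.in_setU negb_or aS aW.
    by rewrite !andbT; apply: contra aX; apply: BX.
  - by apply/finset.set0Pn; exists b; rewrite inE connect0.
  - move=> x s; rewrite finset.in_setD finset.in_setU negb_or => /andP[/andP[xB _] xW].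
    elim: s x xB xW => [|y s IHs] x xB xW /=; first by rewrite (negbTE xB).
    case/andP=> exy hp /andP[yW sW] hl.
    have [yB|yB] := boolP (y \in B).
      by rewrite (BS _ _ yB xW _ xB) // e_sym.
    by apply/orP; right; apply: (IHs y).
(* Nonadjacent [s] and [t] in [S] both have neighbours in [B]. A path within [X] joining these
   neighbours, preceded by [t], is the required [t :: D]. *)
rewrite negb_forall => /existsP[s]; rewrite negb_imply => /andP[sS].
rewrite negb_forall => /existsP[t]; rewrite !negb_imply.
case/and3P=> tS st nest; right.
have := sS; have := tS.
rewrite !inE => /and3P[_ _ /exists_inP[w wB ewt]] /and3P[_ _ /exists_inP[x xB exs]].
have : connect er w x.
  have := wB; have := xB; rewrite !inE => hx.
  by rewrite er_sym => /connect_trans; apply.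
case/connectP => p hp xp.
exists a, s, t, (w :: p); split.
- rewrite /= e_sym ewt /=; apply: sub_path hp => u v /=.
  by case/andP.
- exact: Sa.
- exact: Sa.
- by rewrite /= -xp.
- move=> v; rewrite inE => /orP[/eqP ->|].
    by split; [apply: contraNneq aS => <- | rewrite eq_sym |
      rewrite (negbTE nest) andbF].
  move=> /(path_within hp (BX _ wB)) => vX; split.
  + by apply: contraNneq aX => <-.
  + by move: vX; apply: contraTneq => ->; rewrite inE Sa // !andbF.
  + by move: vX; rewrite inE => /and3P[_ _ /negbTE ->].
Qed.

End Obstruction.

Local Open Scope ring_scope.

(** * Tables and their margins *)

Section SumOut.
Context (V : finType) (I : V -> finType).
Implicit Types (C D W : {set V}) (j k l : state I).

(** Agreement off [~: C] means lying in the same [C]-cell. Tables on [C] can thus be functions of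
    full states that are constant on these classes, without dependent types. *)
Definition eqoff D j k : bool := [forall v, (v \notin D) ==> (j v == k v)].

Lemma eqoffP D j k : reflect (forall v, v \notin D -> j v = k v) (eqoff D j k).
Proof.
by apply: (iffP forallP) => h v; have := h v; [move/implyP=> {}h /h/eqP|
  move=> {}h; apply/implyP => /h ->].
Qed.

Lemma eqoff_refl D j : eqoff D j j. Proof. exact/eqoffP. Qed.

Lemma eqoff_sym D j k : eqoff D j k = eqoff D k j.
Proof. by apply: eq_forallb => v; rewrite eq_sym. Qed.

Lemma eqoff_trans D j k l : eqoff D j k -> eqoff D k l -> eqoff D j l.
Proof. by move=> /eqoffP jk /eqoffP kl; apply/eqoffP => v vD; rewrite jk ?kl. Qed.

Lemma eqoffS D D' j k : D \subset D' -> eqoff D j k -> eqoff D' j k.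
Proof.
move=> /fintype.subsetP DD' /eqoffP h; apply/eqoffP => v vD'; apply: h.
by apply: contra vD'; apply: DD'.
Qed.

Lemma eqoffT j k : eqoff [set: V] j k.
Proof. by apply/eqoffP => v; rewrite inE. Qed.

Lemma eqoff0 j k : eqoff finset.set0 j k = (k == j).
Proof.
apply/eqoffP/eqP => [h|-> //]; apply/ffunP => v; apply/esym/h.
by rewrite inE.
Qed.

Definition splice D j k : state I := [ffun v => if v \in D then k v else j v].

Lemma eqoff_splice D j k : eqoff D j (splice D j k).
Proof. by apply/eqoffP => v /negbTE vD; rewrite ffunE vD. Qed.

Lemma eqoff_spliceC D j k : eqoff (~: D) k (splice D j k).
Proof. by apply/eqoffP => v; rewrite inE negbK => vD; rewrite ffunE vD. Qed.

Section Operator.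
Context (A : nmodType).
Implicit Types f g : state I -> A.

Definition sumout D f j : A := \sum_(k | eqoff D j k) f k.

Definition depends_on (B : Type) W (g : state I -> B) : Prop :=
  forall j k, eqoff (~: W) j k -> g j = g k.

Lemma depends_onS (B : Type) W W' (g : state I -> B) :
  W \subset W' -> depends_on W g -> depends_on W' g.
Proof. by move=> WW' h j k jk; apply: h; apply: eqoffS jk; rewrite finset.setCS. Qed.

Lemma sumout_dep D f : depends_on (~: D) (sumout D f).
Proof.
move=> j k; rewrite finset.setCK => jk; apply: eq_bigl => l.
by apply/idP/idP; apply: eqoff_trans => //; rewrite eqoff_sym.
Qed.

Lemma eq_sumout D f g j : f =1 g -> sumout D f j = sumout D g j.
Proof. by move=> fg; apply: eq_bigr. Qed.

Lemma sumoutT f j : sumout [set: V] f j = \sum_k f k.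
Proof. by apply: eq_bigl => k; rewrite eqoffT. Qed.

Lemma sumoutU D D' f j : [disjoint D & D'] ->
  sumout (D :|: D') f j = sumout D (sumout D' f) j.
Proof.
move=> dD; rewrite /sumout (exchange_big_dep (eqoff (D :|: D') j)) /=; last first.
  move=> l k jl lk; apply: (@eqoff_trans _ _ l).
    by apply: eqoffS jl; rewrite finset.subsetUl.
  by apply: eqoffS lk; rewrite finset.subsetUr.
(* The only state reached from [j] by changing [D] and leading to [k] by changing [D'] is
   [splice D j k]. *)
apply: eq_bigr => k /eqoffP jk; rewrite (big_pred1 (splice D j k)) // => l /=.
apply/andP/eqP => [[/eqoffP jl /eqoffP lk]|->].
  apply/ffunP => v; rewrite ffunE; case: ifPn => vD; last by rewrite jl.
  by rewrite lk // (disjointFr dD).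
split; first exact: eqoff_splice.
apply/eqoffP => v vD'; rewrite ffunE; case: ifPn => // vD; apply: jk.
by rewrite inE negb_or vD.
Qed.

End Operator.

Lemma sumoutM (R : pzSemiRingType) D (f g : state I -> R) j :
  depends_on (~: D) g -> sumout D (fun k => g k * f k) j = g j * sumout D f j.
Proof.
move=> hg; rewrite /sumout mulr_sumr; apply: eq_bigr => k jk.
by rewrite (hg j k) // finset.setCK.
Qed.

Lemma natr_sumout (R : pzSemiRingType) D (f : state I -> nat) j :
  (sumout D f j)%:R = sumout D (fun k => (f k)%:R : R) j.
Proof. exact: natr_sum. Qed.

Lemma sumout_ge0 (R : numDomainType) D (f : state I -> R) j :
  (forall k, 0 <= f k) -> 0 <= sumout D f j.
Proof. by move=> h; apply: sumr_ge0. Qed.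

Lemma sumout_ge (R : numDomainType) D (f : state I -> R) j :
  (forall k, 0 <= f k) -> f j <= sumout D f j.
Proof.
move=> h; rewrite /sumout (bigD1 j) /= ?eqoff_refl //.
by rewrite lerDl sumr_ge0.
Qed.

Definition marginal (A : nmodType) (f : state I -> A) C : state I -> A :=
  sumout (~: C) f.

Lemma marginalS (A : nmodType) (f : state I -> A) C C' j : C' \subset C ->
  sumout (C :\: C') (marginal f C) j = marginal f C' j.
Proof.
move=> CC'; rewrite /marginal -sumoutU; last first.
  by apply/pred0P => v /=; rewrite !inE; case: (v \in C); rewrite ?andbF.
congr (sumout _ f j); apply/setP => v; rewrite !inE.
case vC': (v \in C') => /=; first by rewrite (fintype.subsetP CC').
by case: (v \in C).
Qed.

(** * Consistent families of margins *)

Section Consistent.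
Context (e : rel V) (R : numDomainType).

(* Only the tables [b C] on complete sets [C] matter. *)
Record consistent (b : {set V} -> state I -> R) : Prop := Consistent {
  consistent_dep : forall C, complete_set e C -> depends_on C (b C);
  consistent_ge0 : forall C j, complete_set e C -> 0 <= b C j;
  consistent_sum : forall C C' j, complete_set e C -> C' \subset C ->
    sumout (C :\: C') (b C) j = b C' j }.

Lemma marginal_consistent (f : state I -> R) :
  (forall j, 0 <= f j) -> consistent (marginal f).
Proof.
move=> f0; split=> [C _|C j _|C C' j _]; last exact: marginalS.
  by have := @sumout_dep R (~: C) f; rewrite finset.setCK.
exact: sumout_ge0.
Qed.

Lemma marginal_nat_consistent (u : state I -> nat) :
  consistent (fun C j => (marginal u C j)%:R).
Proof.
have [|h1 h2 h3] := @marginal_consistent (fun j => (u j)%:R) => //.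
split=> [C cC j k jk|C j _|C C' j cC CC'] //.
  by rewrite !natr_sumout; apply: h1.
rewrite [RHS]natr_sumout -/(marginal _ C' j) -(h3 C) //.
by apply: eq_sumout => k; rewrite natr_sumout.
Qed.

Lemma consistent_le b C C' j : consistent b -> complete_set e C -> C' \subset C ->
  b C j <= b C' j.
Proof.
move=> hb cC CC'; rewrite -(consistent_sum hb j cC CC'); apply: sumout_ge => k.
exact: consistent_ge0.
Qed.

End Consistent.
End SumOut.

(** * The log-linear model *)

Section Design.
Context (V : finType) (e : rel V) (I : V -> finType).
Implicit Types (C W : {set V}) (j k : state I) (r : marginal_cell e I).

Definition clique := {C : {set V} | is_clique e C}.

Definition cell (K : clique) j : marginal_cell e I :=
  Tagged (fun K : clique => marginal_state I (val K)) (restrict_state (val K) j).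

Lemma restrict_state_eq C j k :
  (restrict_state C j == restrict_state C k) = eqoff (~: C) j k.
Proof.
apply/eqP/eqoffP => [h v|h].
  rewrite inE negbK => vC; have /ffunP/(_ (exist _ v vC)) := h.
  by rewrite !ffunE.
by apply/ffunP => -[v vC]; rewrite !ffunE /=; apply: h; rewrite inE negbK.
Qed.

Lemma design_cell K j k : design (cell K j) k = eqoff (~: val K) j k.
Proof. by rewrite /design /= restrict_state_eq eqoff_sym. Qed.

Lemma sum_design (R : pzRingType) (theta : marginal_cell e I -> R) j :
  \sum_r theta r * (design r j)%:R = \sum_K theta (cell K j).
Proof.
transitivity (\sum_K \sum_(t : marginal_state I (val K))
    let r := Tagged (fun K : clique => marginal_state I (val K)) t in
    theta r * (design r j)%:R).
  rewrite sig_big_dep /=; apply: eq_bigr => -[K t] _ //.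
apply: eq_bigr => K _; rewrite (bigD1 (restrict_state (val K) j)) //=.
rewrite /design /= eqxx mulr1 big1 ?addr0 // => t /negbTE.
by rewrite eq_sym => ->; rewrite mulr0.
Qed.

Lemma suffstat_cell u K j : suffstat e u (cell K j) = marginal u (val K) j.
Proof.
rewrite ffunE /marginal /sumout [RHS]big_mkcond; apply: eq_bigr => k _ /=.
by rewrite design_cell; case: ifP; rewrite ?mul1n ?mul0n.
Qed.

(** Every complete set lies in a clique, so the clique margins determine the margins on all complete
    sets. *)
Lemma suffstat_marginal (u v : counts I) :
  suffstat e u = suffstat e v <->
  forall C j, complete_set e C -> marginal u C j = marginal v C j.
Proof.
split=> [h C j cC|h].
  have [K qK CK] := complete_set_clique cC.
  rewrite -(marginalS u j CK) -(marginalS v j CK); apply: eq_sumout => k.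
  by rewrite -!(suffstat_cell _ (exist _ K qK)) h.
apply/ffunP => -[K t].
(* A cell [t] to which no state restricts has statistic 0 for both tables. *)
have [k /eqP <-|nk] := pickP (fun k => restrict_state (val K) k == t).
  rewrite -/(cell K k) !suffstat_cell h //.
  exact: maxsetp (valP K).
by rewrite !ffunE !big1 // => k _; rewrite /design /= nk.
Qed.

(** * The row span, the open model and its closure *)

Section RowSpan.
Context (R : realType).

Definition in_rowspan (f : state I -> R) : Prop :=
  exists theta : marginal_cell e I -> R,
    forall j, f j = \sum_r theta r * (design r j)%:R.

(** Put all weight on the rows of one clique [K] containing [C]: exactly one of them matches a given
    state, and [f] is constant on the states it matches. *)
Lemma in_rowspan_dep C f : complete_set e C -> depends_on C f -> in_rowspan f.
Proof.
move=> cC; have [K qK CK] := complete_set_clique cC.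
move=> /(depends_onS CK) hf.
pose theta r : R := if val (tag r) == K then
  (if [pick k | restrict_state (val (tag r)) k == tagged r] is Some k then f k
   else 0) else 0.
exists theta => j; rewrite sum_design (bigD1 (exist _ K qK)) //= big1 ?addr0.
  rewrite /theta /= eqxx; case: pickP => [k|/(_ j)]; last by rewrite eqxx.
  by rewrite restrict_state_eq eqoff_sym => /hf.
by move=> K'; rewrite -val_eqE /theta /= => /negbTE ->.
Qed.

Lemma in_rowspanD f g : in_rowspan f -> in_rowspan g ->
  in_rowspan (fun j => f j + g j).
Proof.
move=> [s hs] [t ht]; exists (fun r => s r + t r) => j.
by rewrite hs ht -big_split; apply: eq_bigr => r _; rewrite mulrDl.
Qed.

Lemma in_rowspanN f : in_rowspan f -> in_rowspan (fun j => - f j).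
Proof.
move=> [s hs]; exists (fun r => - s r) => j.
by rewrite hs -sumrN; apply: eq_bigr => r _; rewrite mulNr.
Qed.

Lemma in_rowspan_cst c : in_rowspan (fun=> c).
Proof. by apply: (in_rowspan_dep (complete_set0 e)). Qed.

Lemma sum_suffstat (u : counts I) (theta : marginal_cell e I -> R) :
  \sum_j (u j)%:R * \sum_r theta r * (design r j)%:R =
  \sum_r theta r * (suffstat e u r)%:R.
Proof.
under eq_bigr do rewrite mulr_sumr; rewrite exchange_big /=.
apply: eq_bigr => r _; rewrite ffunE natr_sum mulr_sumr; apply: eq_bigr => j _.
by rewrite natrM mulrCA [_%:R * _%:R in LHS]mulrC.
Qed.

Local Open Scope classical_set_scope.
Local Notation open_model := (@open_model V e I R).
Local Notation model := (@model V e I R).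

(** Normalising shifts the logarithm by the constant [- ln N], and constants lie in the row span
    because the empty set is complete. *)
Lemma open_model_norm f (N := \sum_j expR (f j)) : in_rowspan f -> 0 < N ->
  open_model (fun j => expR (f j) / N).
Proof.
move=> hf N0; split=> [j||]; first by rewrite divr_gt0 ?expR_gt0.
  by rewrite -mulr_suml divff ?gt_eqF.
have [t ht] := in_rowspanD hf (in_rowspan_cst (- ln N)).
exists t => j; rewrite -ht lnM ?posrE ?expR_gt0 ?invr_gt0 //.
by rewrite expRK lnV ?posrE.
Qed.

Lemma eval_continuous j : continuous (fun p : {ptws state I -> R} => p j).
Proof. exact: (@proj_continuous (state I) (fun=> R) j). Qed.

Lemma model_closed (F G : {ptws state I -> R} -> R) :
  continuous F -> continuous G -> (forall p, open_model p -> F p = G p) ->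
  forall p, model p -> F p = G p.
Proof.
move=> cF cG FG p hp; apply/eqP; rewrite -subr_eq0; apply/eqP.
have cl : closed ((fun p => F p - G p) @^-1` [set x : R | x = 0]).
  apply: (preimage_closed _ (@closed_eq R 0)) => q _.
  exact: (@continuousB R R _ F G q (cF q) (cG q)).
rewrite /model closureE in hp; apply: (hp _ (conj cl _)) => q /FG /= ->.
exact: subrr.
Qed.

Lemma model_sum p : model p -> \sum_j p j = 1.
Proof.
have cF : continuous (fun p : {ptws state I -> R} => \sum_j p j).
  apply: (@continuous_big R (state I) +%R 0 predT).
    exact: add_continuous.
  move=> j _.
  exact: eval_continuous.
by apply: (model_closed (G := cst 1) cF) => [|q []//]; exact: cst_continuous.
Qed.

Lemma model_ge0 p j : model p -> 0 <= p j.
Proof.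
move=> hp.
have cl : closed ((fun p : {ptws state I -> R} => p j) @^-1` [set x : R | 0 <= x]).
  apply: (preimage_closed _ (@closed_ge R 0)) => q _; exact: eval_continuous.
rewrite /model closureE in hp; apply: (hp _ (conj cl _)) => q [/(_ j) /ltW].
by [].
Qed.

Lemma monomial_expR (u : counts I) (theta : marginal_cell e I -> R) p :
  (forall j, 0 < p j) -> (forall j, ln (p j) = \sum_r theta r * (design r j)%:R) ->
  \prod_j p j ^+ u j = expR (\sum_r theta r * (suffstat e u r)%:R).
Proof.
move=> p0 hp; rewrite -sum_suffstat expR_sum; apply: eq_bigr => j _.
by rewrite -hp mulrC expRM_natr lnK ?posrE.
Qed.

(** The binomial equations of the model. On the open model a monomial depends on its exponent
    through the sufficient statistics only; continuity extends this to the closure. *)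
Lemma model_monomial (u v : counts I) p : suffstat e u = suffstat e v -> model p ->
  \prod_j p j ^+ u j = \prod_j p j ^+ v j.
Proof.
move=> uv; have cont (w : counts I) :
    continuous (fun p : {ptws state I -> R} => \prod_j p j ^+ w j).
  apply: (@continuous_big R (state I) *%R 1 predT); first exact: mul_continuous.
  move=> j _ q.
  exact: (continuous_comp (@eval_continuous j q) (@exprn_continuous R _ _)).
apply: (model_closed (cont u) (cont v)) => q [q0 _ [t ht]].
by rewrite !(monomial_expR _ q0 ht) uv.
Qed.

Lemma model_cvg (q : nat -> state I -> R) p : (forall n, open_model (q n)) ->
  (forall j, q n j @[n --> \oo] --> p j) -> model p.
Proof.
move=> hq qp.
have qcvg : {ptws, q n @[n --> \oo] --> p}.
  exact: ((@pointwise_cvgP (discrete_topology (state I)) R _ p _).2 qp).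
apply: (closed_cvg _ (@closed_closure _ open_model) _ _ qcvg).
by near=> n; apply: subset_closure.
Unshelve. all: by end_near.
Qed.

End RowSpan.
End Design.

(** * Unbiased estimators *)

Section Counts.
Context (V : finType) (I : V -> finType).
Implicit Types (j k : state I) (u : counts I).

(** A duplicate-free list, so that sums over tables can be reindexed between different totals. *)
Definition counts_of n : seq (counts I) :=
  [seq to_counts w | w <- enum [pred w : {ffun state I -> 'I_n.+1} |
                                total_count (to_counts w) == n]].

Lemma count_le_total u j : (u j <= total_count u)%N.
Proof. by rewrite /total_count (bigD1 j) //= leq_addr. Qed.

Lemma mem_counts_of n u : (u \in counts_of n) = (total_count u == n).
Proof.
apply/mapP/eqP => [[w]|un]; first by rewrite mem_enum inE => /eqP wn ->.
have uE : u = to_counts [ffun j => inord (u j) : 'I_n.+1].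
  by apply/ffunP => j; rewrite !ffunE inordK // ltnS -un count_le_total.
by eexists; last exact: uE; rewrite mem_enum inE -uE un.
Qed.

Lemma counts_of_uniq n : uniq (counts_of n).
Proof.
rewrite map_inj_uniq ?enum_uniq // => w w' /ffunP h; apply/ffunP => j.
by apply/val_inj; have := h j; rewrite !ffunE.
Qed.

Definition incr j u : counts I := [ffun k => (u k + (k == j))%N].

Lemma total_incr j u : total_count (incr j u) = (total_count u).+1.
Proof.
rewrite /total_count; under eq_bigr do rewrite ffunE; rewrite big_split /=.
rewrite -addn1; congr addn; rewrite (bigD1 j) //= eqxx big1 ?addn0 // => k.
by move/negbTE ->.
Qed.

Lemma marginal_incr j u (C : {set V}) k :
  marginal (incr j u) C k = (marginal u C k + eqoff (~: C) k j)%N.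
Proof.
rewrite /marginal /sumout; under eq_bigr do rewrite ffunE.
rewrite big_split /=; congr addn; case kj: eqoff => /=.
  rewrite (bigD1 j) //= eqxx big1 ?addn0 // => l /andP[_ /negbTE ->//].
rewrite big1 // => l kl; case: eqP => // lj.
by rewrite -lj kl in kj.
Qed.

Lemma perm_incr j n :
  perm_eq [seq u : counts I <- counts_of n.+1 | (0 < u j)%N]
          [seq incr j u | u <- counts_of n].
Proof.
apply: uniq_perm; first by rewrite filter_uniq // counts_of_uniq.
  rewrite map_inj_uniq ?counts_of_uniq // => u v /ffunP h; apply/ffunP => k.
  by have := h k; rewrite !ffunE => /addIn.
move=> u; rewrite mem_filter mem_counts_of; apply/andP/mapP => [[u0 /eqP un]|[v]].
  pose v : counts I := [ffun k => (u k - (k == j))%N].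
  have uE : u = incr j v.
    apply/ffunP => k; rewrite !ffunE subnK //; case: eqP => // ->; exact: u0.
  exists v => //; rewrite mem_counts_of -eqSS -(total_incr j) -uE; exact/eqP.
rewrite mem_counts_of => /eqP vn ->.
by rewrite ffunE eqxx addn1 total_incr vn.
Qed.

(** * Sums over tables weighted by inverse factorials *)

Section Weighted.
Context (R : numFieldType).

Definition invfact u : R := (\prod_k (u k)`!%:R)^-1.

Lemma invfact_incr j u : (incr j u j)%:R * invfact (incr j u) = invfact u.
Proof.
rewrite /invfact [X in _ * X^-1](bigD1 j) //= [in RHS](bigD1 j) //= !ffunE eqxx.
rewrite addn1 factS natrM -mulrA invfM mulrA divff ?pnatr_eq0 // mul1r.
congr (_ * _)^-1; apply: eq_bigr => k /negbTE kj.
by rewrite ffunE kj addn0.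
Qed.

(** The terms match under [incr j]: the factor [u j] reduces one factorial, and tables with
    [u j = 0] contribute nothing. *)
Lemma sum_counts_shift (A : pred (counts I)) j n (h : counts I -> R) :
  \sum_(u <- counts_of n.+1 | A u) (u j)%:R * invfact u * h u =
  \sum_(u <- counts_of n | A (incr j u)) invfact u * h (incr j u).
Proof.
transitivity (\sum_(u <- [seq u : counts I <- counts_of n.+1 | (0 < u j)%N] | A u)
   (u j)%:R * invfact u * h u).
  rewrite big_filter_cond [RHS]big_mkcondl; apply: eq_bigr => u _.
  by case: posnP => // ->; rewrite !mul0r.
rewrite (perm_big _ (perm_incr j n)) big_map; apply: eq_bigr => u _.
by rewrite invfact_incr.
Qed.

(** The factor [n.+1] is the sum of the entries of each table; split it over the cells and remove
    one unit from each. *)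
Lemma sum_counts_rec (A : pred (counts I)) n (h : counts I -> R) :
  n.+1%:R * \sum_(u <- counts_of n.+1 | A u) invfact u * h u =
  \sum_j \sum_(u <- counts_of n | A (incr j u)) invfact u * h (incr j u).
Proof.
under [RHS]eq_bigr do rewrite -sum_counts_shift.
rewrite exchange_big mulr_sumr big_seq_cond [RHS]big_seq_cond /=.
apply: eq_bigr => u /andP[]; rewrite mem_counts_of => /eqP <- _.
rewrite natr_sum mulr_suml; apply: eq_bigr => j _; exact: mulrA.
Qed.

Lemma perm_counts_of0 : perm_eq (counts_of 0) [:: [ffun=> 0%N]].
Proof.
apply: uniq_perm => //; first exact: counts_of_uniq.
move=> u; rewrite mem_counts_of inE; apply/eqP/eqP => [u0|->].
  by apply/ffunP => j; have := count_le_total u j; rewrite u0 leqn0 ffunE => /eqP.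
by rewrite /total_count big1 // => j _; rewrite ffunE.
Qed.

Lemma sum_counts0 (A : pred (counts I)) (h : counts I -> R) :
  A [ffun=> 0%N] -> \sum_(u <- counts_of 0 | A u) invfact u * h u = h [ffun=> 0%N].
Proof.
move=> A0; rewrite (perm_big _ perm_counts_of0) big_mkcond big_seq1 A0.
rewrite /invfact big1 ?invr1 ?mul1r // => k _.
by rewrite ffunE.
Qed.

Lemma monomial_incr j u (p : state I -> R) :
  \prod_k p k ^+ incr j u k = p j * \prod_k p k ^+ u k.
Proof.
rewrite (bigD1 j) //= [in RHS](bigD1 j) //= mulrA ffunE eqxx addn1 exprS.
congr (_ * _); apply: eq_bigr => k /negbTE kj.
by rewrite ffunE kj addn0.
Qed.

Lemma sum_multinomial n (p : state I -> R) : \sum_j p j = 1 ->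
  \sum_(u <- counts_of n) invfact u * \prod_j p j ^+ u j = n`!%:R^-1.
Proof.
move=> p1; elim: n => [|n IH].
  rewrite sum_counts0 // big1 ?invr1 // => j _.
  by rewrite ffunE.
apply: (@mulfI _ n.+1%:R); first by rewrite pnatr_eq0.
rewrite sum_counts_rec factS natrM invfM mulrA divff ?pnatr_eq0 // mul1r.
under eq_bigr => j _ do
  (under eq_bigr do rewrite monomial_incr mulrCA; rewrite -mulr_sumr IH).
by rewrite -mulr_suml p1 mul1r.
Qed.

End Weighted.

(** * Unbiasedness on the fibres of the sufficient statistics *)

Section Unbiased.
Context (R : realType) (e : rel V).

Lemma expectationE n (p : state I -> R) f :
  expectation n p f =
  n`!%:R * \sum_(u <- counts_of n) invfact R u * \prod_j p j ^+ u j * f u.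
Proof.
rewrite /expectation /counts_of big_map big_enum_cond mulr_sumr.
apply: eq_big => [w|w _]; first by rewrite inE andbT.
by rewrite /multinomial_pmf /invfact !mulrA.
Qed.

Lemma expectation_count n (p : state I -> R) j : \sum_k p k = 1 ->
  expectation n p (fun u => (u j)%:R) = n%:R * p j.
Proof.
move=> p1; rewrite expectationE; case: n => [|n].
  rewrite mul0r big_seq big1 ?mulr0 // => u; rewrite mem_counts_of => /eqP u0.
  by have := count_le_total u j; rewrite u0 leqn0 => /eqP ->; rewrite mulr0.
under eq_bigr do rewrite mulrC mulrA; rewrite sum_counts_shift.
under eq_bigr do rewrite monomial_incr mulrCA.
rewrite -mulr_sumr sum_multinomial // factS natrM mulrCA -!mulrA divff ?mulr1.
  exact: mulrC.
by rewrite pnatr_eq0 -lt0n fact_gt0.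
Qed.

Local Notation cells := (marginal_cell e I).

(* Artin's independence of characters, for the characters
   [tau |-> expR (\sum_r tau r * b r)]. *)
Lemma expR_independent (s : seq {ffun cells -> nat}) (c : {ffun cells -> nat} -> R) :
  uniq s ->
  (forall tau : cells -> R,
     \sum_(b <- s) c b * expR (\sum_r tau r * (b r)%:R) = 0) ->
  {in s, forall b, c b = 0}.
Proof.
elim: s c => // b0 s IH c /= /andP[b0s us] h0.
have hs : {in s, forall b, c b = 0}.
  move=> b bs; have /eqP : b != b0 by apply: contraNneq b0s => <-.
  move/ffunP/existsNP => [r0 br].
  (* The coordinate [r0] separates [b] from [b0]. Shifting [tau] by [d] and subtracting
     [expR (b0 r0)%:R] times the original relation kills the [b0] term, so the induction hypothesis
     applies to [s]. *)
  pose d r : R := (r == r0)%:R.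
  have sumd (b' : {ffun cells -> nat}) : \sum_r d r * (b' r)%:R = (b' r0)%:R.
    rewrite (bigD1 r0) //= /d eqxx mul1r big1 ?addr0 // => r /negbTE ->.
    exact: mul0r.
  have := IH (fun b => c b * (expR (b r0)%:R - expR (b0 r0)%:R)) us _ b bs.
  have /negbTE ne : expR (b r0)%:R - expR (b0 r0)%:R != 0 :> R.
    by rewrite subr_eq0 (inj_eq (@expR_inj R)) eqr_nat; apply/eqP.
  move=> /(_ _)/eqP; rewrite mulf_eq0 ne orbF => h; apply/eqP; apply: h => tau.
  have := h0 (fun r => tau r + d r); have := h0 tau; rewrite !big_cons => e1 e2.
  have expE (b' : {ffun cells -> nat}) : expR (\sum_r (tau r + d r) * (b' r)%:R) =
      expR (\sum_r tau r * (b' r)%:R) * expR (b' r0)%:R.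
    by rewrite -expRD -(sumd b') -big_split; congr expR; apply: eq_bigr => r _;
       rewrite mulrDl.
  transitivity (\sum_(b <- s) c b * expR (\sum_r (tau r + d r) * (b r)%:R)
     - expR (b0 r0)%:R * \sum_(b <- s) c b * expR (\sum_r tau r * (b r)%:R)).
    rewrite mulr_sumr -sumrB; apply: eq_bigr => b' _; rewrite expE.
    ring.
  have -> : \sum_(b <- s) c b * expR (\sum_r (tau r + d r) * (b r)%:R) =
    - (c b0 * expR (\sum_r (tau r + d r) * (b0 r)%:R)).
    by apply/eqP; rewrite -addr_eq0 addrC e2.
  have -> : \sum_(b <- s) c b * expR (\sum_r tau r * (b r)%:R) =
    - (c b0 * expR (\sum_r tau r * (b0 r)%:R)).
    by apply/eqP; rewrite -addr_eq0 addrC e1.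
  rewrite expE; ring.
move=> b; rewrite inE => /orP[/eqP ->|]; last exact: hs.
have := h0 (fun=> 0); rewrite big_cons.
rewrite [X in _ + X]big_seq [X in _ + X]big1 ?addr0; last first.
  by move=> b' bs; rewrite (hs _ bs) mul0r.
by rewrite big1 ?expR0 ?mulr1 // => r _; rewrite mul0r.
Qed.

Lemma big_fibers (B : eqType) (A : Type) (f : A -> B) (r : seq A) (F : A -> R) :
  \sum_(a <- r) F a = \sum_(b <- undup (map f r)) \sum_(a <- r | f a == b) F a.
Proof.
rewrite (exchange_big_dep xpredT) //=.
have : {subset map f r <= undup (map f r)} by move=> b; rewrite mem_undup.
move: (undup _) (undup_uniq (map f r)) => t ut.
elim: r => [|a s IH] hs; first by rewrite !big_nil.
rewrite !big_cons -IH; last by move=> b bs; apply: hs; rewrite inE bs orbT.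
congr +%R; under eq_bigl do rewrite eq_sym.
rewrite -big_filter filter_pred1_uniq //.
  by rewrite big_seq1.
by apply: hs; rewrite inE eqxx.
Qed.

(** At normalised exponentials of row-span elements, unbiasedness is a vanishing combination of
    characters of the sufficient statistics. Hence the error of [T] against [u j], weighted by
    [invfact], sums to 0 over each fibre. *)
Lemma unbiased_fiber (T : {ffun cells -> nat} -> state I -> R) j (u0 : counts I) :
  (forall n, unbiased e n j (fun u => T (suffstat e u) j)) ->
  T (suffstat e u0) j *
    \sum_(u <- counts_of (total_count u0) | suffstat e u == suffstat e u0)
      invfact R u =
  \sum_(u <- counts_of (total_count u0) | suffstat e u == suffstat e u0)
    (u j)%:R * invfact R u.
Proof.
set n := total_count u0 => hT; apply/eqP; rewrite -subr_eq0 mulr_sumr -sumrB; apply/eqP.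
pose F u := (T (suffstat e u) j - (u j)%:R) * invfact R u.
pose c b := \sum_(u <- counts_of n | suffstat e u == b) F u.
suff h : {in undup (map (@suffstat V e I) (counts_of n)), forall b, c b = 0}.
  have /h c0 : suffstat e u0 \in undup (map (@suffstat V e I) (counts_of n)).
    by rewrite mem_undup map_f ?mem_counts_of.
  by rewrite -[RHS]c0; apply: eq_bigr => u /eqP <-; rewrite /F mulrBl.
apply: expR_independent; first exact: undup_uniq.
move=> tau; pose f k := \sum_r tau r * (design r k)%:R : R.
have row : in_rowspan e f by exists tau.
have N0 : 0 < \sum_k expR (f k).
  by rewrite (bigD1 j) //= ltr_wpDr ?expR_gt0 // sumr_ge0 // => k _; exact: expR_ge0.
have hp := open_model_norm row N0; set N := \sum_k _ in N0 hp.
have [_ p1 _] := hp.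
have := hT n _ (subset_closure hp); rewrite -(expectation_count n j p1).
rewrite !expectationE => /eqP.
rewrite (inj_eq (mulfI _)) ?pnatr_eq0 -?lt0n ?fact_gt0 // -subr_eq0 -sumrB => /eqP h.
have {}h : \sum_(u <- counts_of n) F u * expR (\sum_r tau r * (suffstat e u r)%:R) = 0.
  (* All tables in the sum have total [n], so the normalising constant contributes the common factor
     [N ^- n]. *)
  apply: (@mulfI _ (N ^- n)); first by rewrite invr_eq0 expf_neq0 // gt_eqF.
  rewrite mulr0 -[RHS]h mulr_sumr big_seq [RHS]big_seq; apply: eq_bigr => u.
  rewrite mem_counts_of => /eqP un.
  have -> : \prod_k (expR (f k) / N) ^+ u k =
     expR (\sum_r tau r * (suffstat e u r)%:R) * N ^- n.
    under eq_bigr do rewrite expr_div_n; rewrite prodf_div; congr (_ / _).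
      by rewrite -sum_suffstat expR_sum; apply: eq_bigr => k _;
         rewrite mulrC expRM_natr.
    by rewrite prodrXr -un.
  rewrite -mulrBr /F; set a := _ - _; set x := expR _; set y := _^-1.
  by rewrite mulrC -!mulrA [a * _]mulrC -!mulrA.
rewrite -[RHS]h [RHS](big_fibers (@suffstat V e I)); apply: eq_bigr => b _.
by rewrite /c mulr_suml; apply: eq_bigr => u /eqP ->.
Qed.

End Unbiased.
End Counts.

(** * The UMVUE is not the MLE when the graph is not decomposable *)

Section ChordlessCycle.
Context (V : finType) (e : rel V) (I : V -> finType).
Hypotheses (e_sym : symmetric e) (e_irr : irreflexive e).
Context (alpha : forall v, I v * I v).
Hypothesis alpha_neq : forall v, (alpha v).1 != (alpha v).2.
Context (a s t : V) (D : seq V).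
Hypothesis cyc : chordless e a s t D.

Definition level (b : bool) v : I v := if b then (alpha v).2 else (alpha v).1.

(** An embedded 2 x 2 x 2 table: the whole path moves as a single variable, and the vertices off the
    cycle stay at their first level. *)
Definition cube (x y z : bool) : state I :=
  [ffun v => level (if v == a then x else if v == s then y else
                    (v \in t :: D) && z) v].

Lemma level_inj v : injective (level^~ v).
Proof.
by case=> -[] //= /eqP; rewrite /level ?[_.2 == _]eq_sym (negbTE (alpha_neq v)).
Qed.

Let as_neq : (s == a) = false.
Proof.
have [_ + _ _ _] := cyc; apply: contraTF => /eqP ->.
by rewrite e_irr.
Qed.

Let in_D v : v \in t :: D -> (v == a = false) * (v == s = false).
Proof. by have [_ _ _ _ h] := cyc; move/h => [/negbTE -> /negbTE ->]. Qed.

Lemma eqoff_cube (C : {set V}) x y z x' y' z' :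
  eqoff (~: C) (cube x y z) (cube x' y' z') =
  [&& (a \in C) ==> (x == x'), (s \in C) ==> (y == y')
    & has (mem C) (t :: D) ==> (z == z')].
Proof.
apply/eqoffP/and3P => [h|[/implyP ha /implyP hs /implyP hD] v].
  have {}h v : v \in C -> cube x y z v = cube x' y' z' v.
    by move=> vC; apply: h; rewrite inE negbK.
  split; apply/implyP.
  - by move/h; rewrite !ffunE eqxx => /level_inj ->.
  - by move/h; rewrite !ffunE eqxx as_neq => /level_inj ->.
  - case/hasP => v vD /= /h; rewrite !ffunE !in_D // vD => /level_inj /= ->.
    exact: eqxx.
rewrite inE negbK => vC; rewrite !ffunE; apply: (congr1 (level^~ v)).
case: eqP => [va|_]; first by apply/eqP/ha; rewrite -va.
case: eqP => [vs|_]; first by apply/eqP/hs; rewrite -vs.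
case vD: (v \in t :: D) => //=; apply/eqP/hD/hasP.
by exists v.
Qed.

Lemma cube_eq x y z x' y' z' :
  (cube x y z == cube x' y' z') = [&& x == x', y == y' & z == z'].
Proof.
by rewrite eq_sym -eqoff0 -finset.setCT eqoff_cube /= !inE.
Qed.

(** A vertex of the path sharing a complete set with [a] and [s] would be adjacent to both, which
    [chordless] excludes. *)
Lemma complete_not_transversal (C : {set V}) :
  complete_set e C ->
  ~~ [&& a \in C, s \in C & has (mem C) (t :: D)].
Proof.
move=> /complete_setP cC; apply/negP => /and3P[aC sC /hasP[v vD /= vC]].
have [_ _ _ _ /(_ _ vD)[va vs]] := cyc.
by rewrite !cC // eq_sym.
Qed.

Lemma eqoff_cubel (C : {set V}) k x y z x' y' z' :
  eqoff (~: C) (cube x y z) (cube x' y' z') ->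
  eqoff (~: C) k (cube x y z) = eqoff (~: C) k (cube x' y' z').
Proof.
by move=> h; apply/idP/idP => /eqoff_trans; apply => //; rewrite eqoff_sym.
Qed.

Definition zero_counts : counts I := [ffun=> 0%N].

(** The difference between this table and [odd_counts] is the three-way interaction of the cube, the
    direction invisible to two-way margins. *)
Definition even_counts : counts I :=
  incr (cube false false false) (incr (cube false true true)
   (incr (cube true false true) (incr (cube true true false) zero_counts))).

Definition odd_counts : counts I :=
  incr (cube true true true) (incr (cube true false false)
   (incr (cube false true false) (incr (cube false false true) zero_counts))).

(** A complete set misses one of the three bits, and flipping that bit pairs even cells with odd
    ones. *)
Lemma suffstat_even_odd_incr (j : state I) :
  suffstat e (incr j even_counts) = suffstat e (incr j odd_counts).
Proof.
apply/suffstat_marginal => C k cC; rewrite !marginal_incr.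
have := complete_not_transversal cC.
rewrite !negb_and => /or3P[] /negbTE h.
- have E y z x : eqoff (~: C) k (cube x y z) = eqoff (~: C) k (cube false y z).
    by apply: eqoff_cubel; rewrite eqoff_cube h !eqxx !implybT.
  rewrite !(E _ _ true); lia.
- have E y z x : eqoff (~: C) k (cube x y z) = eqoff (~: C) k (cube x false z).
    by apply: eqoff_cubel; rewrite eqoff_cube h !eqxx !implybT.
  rewrite !(E true); lia.
- have E y z x : eqoff (~: C) k (cube x y z) = eqoff (~: C) k (cube x y false).
    by apply: eqoff_cubel; rewrite eqoff_cube h !eqxx !implybT.
  rewrite !(E _ true); lia.
Qed.

Lemma suffstat_even_odd : suffstat e even_counts = suffstat e odd_counts.
Proof.
apply/suffstat_marginal => C k cC.
have := iffLR (suffstat_marginal _ _ _) (suffstat_even_odd_incr k) C k cC.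
by rewrite !marginal_incr => /addIn.
Qed.

Let c000 := cube false false false.

Lemma sum_cube (F : state I -> nat) :
  (forall k, F k != 0%N -> exists x y z, k = cube x y z) ->
  (\sum_k F k = \sum_x \sum_y \sum_z F (cube x y z))%N.
Proof.
move=> hF; rewrite pair_bigA pair_bigA /=.
pose h (b : bool * bool * bool) := cube b.1.1 b.1.2 b.2.
have hinj : injective h.
  move=> [[x y] z] [[x' y'] z'] /eqP; rewrite cube_eq.
  by case/and3P=> /eqP /= -> /eqP -> /eqP ->.
rewrite (bigID [in h @: predT]) /= addnC big1 ?add0n.
  rewrite big_imset /=; first by apply: eq_bigl.
  by move=> b b' _ _ /hinj.
move=> k; apply: contraNeq => /hF[x [y [z ->]]].
by apply/imsetP; exists (x, y, z).
Qed.

Let complete1 v : complete_set e [set v].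
Proof.
by apply/complete_setP => x y; rewrite !inE => /eqP -> /eqP ->; rewrite eqxx.
Qed.

(** A positive entry at [k] forces [k] to agree with some cube state on each complete set.
    Singletons fix the levels, and the edges of the path carry one value of [z] along it. *)
Lemma support_cube (w : counts I) k :
  suffstat e w = suffstat e (incr c000 even_counts) -> w k != 0%N ->
  exists x y z, k = cube x y z.
Proof.
move=> /suffstat_marginal hw wk.
have supp C : complete_set e C -> exists x y z, eqoff (~: C) k (cube x y z).
  move=> cC; have : marginal w C k != 0%N.
    rewrite -lt0n /marginal /sumout (bigD1 k) ?eqoff_refl //=.
    by rewrite ltn_addr // lt0n.
  rewrite (hw _ _ cC) !marginal_incr; apply: contraNP => h.
  have h' x y z : eqoff (~: C) k (cube x y z) = false.
    by apply/negP => kx; apply: h; exists x, y, z.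
  rewrite !h' /marginal /sumout big1 // => l _; rewrite ffunE //.
have at_ C v x y z : eqoff (~: C) k (cube x y z) -> v \in C -> k v = cube x y z v.
  by move/eqoffP => h vC; apply: h; rewrite inE negbK.
have [x [? [? /at_ /(_ (set11 _))]]] := supp _ (complete1 a).
rewrite ffunE eqxx => ka.
have [? [y [? /at_ /(_ (set11 _))]]] := supp _ (complete1 s).
rewrite ffunE as_neq eqxx => ks.
have [? [? [z /at_ /(_ (set11 _))]]] := supp _ (complete1 t).
rewrite ffunE !in_D ?inE ?eqxx //= => kt.
exists x, y, z; apply/ffunP => v; rewrite ffunE.
case: eqP => [->//|/eqP va]; case: eqP => [->//|/eqP vs].
case vD: (v \in t :: D) => /=; last first.
  have [? [? [? /at_ /(_ (set11 _))]]] := supp _ (complete1 v).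
  by rewrite ffunE (negbTE va) (negbTE vs) vD.
have [hp _ _ _ _] := cyc.
suff along D' d : {subset d :: D' <= t :: D} -> path e d D' ->
    v \in d :: D' -> k d = level z d -> k v = level z v by exact: along hp vD kt.
elim: D' d {hp kt vD} => [|d' D' IH] d hd /=.
  by move=> _; rewrite inE => /eqP ->.
case/andP => edd' hp; rewrite inE => /orP[/eqP -> //|vD] kd.
apply: (IH d') => // [v' v'D|]; first by apply: hd; rewrite inE v'D orbT.
have [? [? [z' /at_ kz]]] := supp _ (complete_edge e_sym edd').
have := kz d (set21 _ _); have := kz d' (set22 _ _).
have d'D : d' \in t :: D by apply: hd; rewrite !inE eqxx orbT.
have dD : d \in t :: D by apply: hd; rewrite inE eqxx.
by rewrite !ffunE !in_D // d'D dD /= => ->; rewrite kd => /level_inj ->.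
Qed.

(** The edges from [a] to [s], from [a] to [t] and from [last t D] to [s] give the three two-way
    margins of the cube. These leave one free integer, and nonnegativity leaves two values for
    it. *)
Lemma fiber_cube (w : counts I) :
  suffstat e w = suffstat e (incr c000 even_counts) ->
  w = incr c000 even_counts \/ w = incr c000 odd_counts.
Proof.
set u := incr c000 even_counts => hw.
have marg (w' : counts I) C k : suffstat e w' = suffstat e u ->
    marginal w' C k =
    (\sum_x \sum_y \sum_z eqoff (~: C) k (cube x y z) * w' (cube x y z))%N.
  move=> hw'; rewrite -(sum_cube (F := fun l => eqoff (~: C) k l * w' l)%N).
    rewrite /marginal /sumout big_mkcond; apply: eq_bigr => l _.
    by case: eqoff; rewrite ?mul1n.
  move=> l; rewrite muln_eq0 negb_or => /andP[_]; exact: support_cube.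
have E C k (cC : complete_set e C) := iffLR (suffstat_marginal _ _ _) hw C k cC.
have [_ eas eat els _] := cyc.
have uv x y z : (u (cube x y z) = [&& ~~ x, ~~ y & ~~ z] + ~~ (x (+) y (+) z))%N.
  rewrite !ffunE !cube_eq; by case: x; case: y; case: z.
have lD : last t D \in t :: D by rewrite mem_last.
have has_t C : t \in C -> has (mem C) (t :: D) by move=> tC; rewrite /= tC.
(* The bit that the edge does not see is set to [false] as a placeholder. *)
have E1 x y := E _ (cube x y false) (complete_edge e_sym eas).
have E2 x z := E _ (cube x false z) (complete_edge e_sym eat).
have E3 y z := E _ (cube false y z) (complete_edge e_sym els).
have has1 : has (mem [set a; s]) (t :: D) = false.
  by apply/negbTE/hasPn => v vD; rewrite /= !inE !in_D.
have has2 : has (mem [set a; t]) (t :: D) by rewrite /= !inE eqxx orbT.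
have has3 : has (mem [set last t D; s]) (t :: D).
  by apply/hasP; exists (last t D); rewrite //= !inE eqxx.
have sat : s \in [set a; t] = false.
  by rewrite !inE as_neq eq_sym in_D ?inE ?eqxx.
have als : a \in [set last t D; s] = false.
  by rewrite !inE eq_sym (in_D lD) eq_sym as_neq.
have F1 x y : (w (cube x y false) + w (cube x y true) =
    u (cube x y false) + u (cube x y true))%N.
  have := E1 x y; rewrite !marg // !big_bool !eqoff_cube has1 !inE !eqxx orbT /=.
  by case: x; case: y; rewrite /= !(mul0n, mul1n, addn0, add0n) addnC => ->;
     exact: addnC.
have F2 x z : (w (cube x false z) + w (cube x true z) =
    u (cube x false z) + u (cube x true z))%N.
  have := E2 x z; rewrite !marg // !big_bool !eqoff_cube has2 sat !inE !eqxx /=.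
  by case: x; case: z; rewrite /= !(mul0n, mul1n, addn0, add0n) addnC => ->;
     exact: addnC.
have F3 y z : (w (cube false y z) + w (cube true y z) =
    u (cube false y z) + u (cube true y z))%N.
  have := E3 y z; rewrite !marg // !big_bool !eqoff_cube has3 als !inE !eqxx orbT /=.
  by case: y; case: z; rewrite /= !(mul0n, mul1n, addn0, add0n) addnC => ->;
     exact: addnC.
have ext (v : counts I) : suffstat e v = suffstat e u ->
    (forall x y z, w (cube x y z) = v (cube x y z)) -> w = v.
  move=> hv wv; apply/ffunP => k.
  have [/(support_cube hw)[x [y [z ->]]]|/negPn/eqP wk] := boolP (w k != 0%N).
    exact: wv.
  have [/(support_cube hv)[x [y [z ->]]]|/negPn/eqP ->//] := boolP (v k != 0%N).
  exact: wv.
have := (F1 false false, F1 false true, F1 true false, F1 true true).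
have := (F2 false false, F2 false true, F2 true false, F2 true true).
have := (F3 false false, F3 false true, F3 true false, F3 true true).
rewrite !uv /= => -[[[e1 e2] e3] e4] [[[e5 e6] e7] e8] [[[e9 e10] e11] e12].
move: e1 e2 e3 e4 e5 e6 e7 e8 e9 e10 e11 e12.
set w0 := w (cube false false false); set w1 := w (cube false false true).
set w2 := w (cube false true false); set w3 := w (cube false true true).
set w4 := w (cube true false false); set w5 := w (cube true false true).
set w6 := w (cube true true false); set w7 := w (cube true true true).
move=> e1 e2 e3 e4 e5 e6 e7 e8 e9 e10 e11 e12.
have [[k0 [k1 [k2 [k3 [k4 [k5 [k6 k7]]]]]]]|[k0 [k1 [k2 [k3 [k4 [k5 [k6 k7]]]]]]]] :
    (w0 = 2 /\ w1 = 0 /\ w2 = 0 /\ w3 = 1 /\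
     w4 = 0 /\ w5 = 1 /\ w6 = 1 /\ w7 = 0 \/
     w0 = 1 /\ w1 = 1 /\ w2 = 1 /\ w3 = 0 /\
     w4 = 1 /\ w5 = 0 /\ w6 = 0 /\ w7 = 1)%N.
- clearbody w0 w1 w2 w3 w4 w5 w6 w7; clear -e1 e2 e3 e4 e5 e6 e7 e8 e9 e10 e11 e12.
  lia.
- left; apply: ext => // x y z; rewrite uv.
  by case: x; case: y; case: z.
right; apply: ext; first by rewrite suffstat_even_odd_incr.
move=> x y z; rewrite !ffunE !cube_eq.
by case: x; case: y; case: z.
Qed.

Lemma chordless_umvue_neq_mle (R : realType)
    (T M : {ffun marginal_cell e I -> nat} -> state I -> R) :
  (forall n j, unbiased e n j (fun u => T (suffstat e u) j)) -> is_mle M ->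
  (forall u j, T (suffstat e u) j = M (suffstat e u) j) -> False.
Proof.
move=> hT hM TM; set u := incr c000 even_counts; set v := incr c000 odd_counts.
have [p [pmod _] Mp] := hM u.
have total0 : total_count zero_counts = 0%N.
  by rewrite /total_count big1 // => k _; rewrite ffunE.
have un : total_count u = 5%N by rewrite !total_incr total0.
have vn : total_count v = 5%N by rewrite !total_incr total0.
have inv0 : invfact R zero_counts = 1.
  by rewrite /invfact big1 ?invr1 // => k _; rewrite ffunE.
have incr1 j (w : counts I) : w j = 0%N -> invfact R (incr j w) = invfact R w.
  by move=> wj; rewrite -[RHS](invfact_incr _ j) ffunE eqxx wj mul1r.
have inve : invfact R even_counts = 1.
  by rewrite !incr1 ?inv0 // !ffunE ?cube_eq.
have invo : invfact R odd_counts = 1.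
  by rewrite !incr1 ?inv0 // !ffunE ?cube_eq.
have invv : invfact R v = 1 by rewrite incr1 // !ffunE ?cube_eq.
(* The entry 2 at [c000] gives the only factorial exceeding 1. *)
have invu : invfact R u = 2^-1.
  have := invfact_incr R c000 even_counts; rewrite inve -/u.
  have -> : u c000 = 2%N by rewrite !ffunE !cube_eq.
  by move=> h; apply: (@mulfI _ 2); rewrite ?h ?divff // pnatr_eq0.
have uv_neq : u != v.
  by apply/eqP => /ffunP/(_ c000); rewrite !ffunE !cube_eq.
have fiber : perm_eq
    [seq w : counts I <- counts_of I 5%N | suffstat e w == suffstat e u] [:: u; v].
  apply: uniq_perm; first by rewrite filter_uniq ?counts_of_uniq.
    by rewrite /= inE uv_neq.
  move=> w; rewrite mem_filter mem_counts_of !inE; apply/andP/orP.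
    by case=> /eqP /fiber_cube [] -> _; [left|right].
  case=> /eqP ->; first by rewrite un !eqxx.
  by rewrite vn !eqxx suffstat_even_odd_incr !eqxx.
have sum_fiber (F : counts I -> R) :
    \sum_(w <- counts_of I 5%N | suffstat e w == suffstat e u) F w = F u + F v.
  by rewrite -big_filter (perm_big _ fiber) big_cons big_seq1.
(* The fibre average with weights 1/2 and 1 reads [T * (3 / 2) = u j / 2 + v j], where
   [T = M = 5 * p j]. *)
have pE j : 15 * p j = (u j)%:R + 2 * (v j)%:R.
  have := unbiased_fiber u (hT^~ j).
  rewrite un !sum_fiber invu invv TM Mp un => h; lra.
(* The binomial equation fails: in units of 1/15 the even cells have product 4, the odd cells 2^4 =
   16. *)
have := model_monomial suffstat_even_odd pmod.
rewrite !monomial_incr !big1 //; try by move=> k _; rewrite ffunE.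
have p1 x y z :
    p (cube x y z) = ((u (cube x y z))%:R + 2 * (v (cube x y z))%:R) / 15.
  by rewrite -pE; lra.
rewrite !p1 !ffunE !cube_eq /=; lra.
Qed.

End ChordlessCycle.

(** * The fitted table of a decomposable graph *)

Section Rational.
Context (V : finType) (I : V -> finType) (R : realType).
Import -(notations) mpoly.
Implicit Types (C : {set V}) (j : state I) (f g : counts I -> R).

Lemma marginal_meval C j : exists P : mpoly #|state I| R,
  forall u : counts I, eval_at u P = (marginal u C j)%:R.
Proof.
exists (\sum_(k | eqoff (~: C) j k) mpolyX _ (mnm1 (enum_rank k))) => u.
rewrite /eval_at raddf_sum natr_sum /=; apply: eq_bigr => k _.
by rewrite mevalXU enum_rankK.
Qed.

Lemma rational_marginal C j :
  rational_in_counts (fun u : counts I => (marginal u C j)%:R : R).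
Proof.
have [P hP] := marginal_meval C j; exists P, 1; split=> u _.
  by rewrite /eval_at meval1 oner_eq0.
by rewrite /eval_at meval1 divr1 -/(eval_at u P) hP.
Qed.

(** The separator margin joins the denominator; it is at least [u j], hence nonzero on positive
    tables. *)
Lemma rational_glue C j f g : rational_in_counts f -> rational_in_counts g ->
  rational_in_counts (fun u => f u * g u / (marginal u C j)%:R).
Proof.
move=> [P1 [Q1 [pos1 E1]]] [P2 [Q2 [pos2 E2]]].
have [PC EC] := marginal_meval C j.
have evalM u (P Q : mpoly #|state I| R) :
  eval_at u (P * Q) = eval_at u P * eval_at u Q by exact: mevalM.
exists (P1 * P2), (Q1 * Q2 * PC); split=> u.
  move=> u0; rewrite !evalM !mulf_neq0 ?pos1 ?pos2 //.
  rewrite EC pnatr_eq0 -lt0n; apply: leq_trans (u0 j) _.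
  by rewrite /marginal /sumout (bigD1 j) ?eqoff_refl //= leq_addr.
rewrite !evalM !mulf_eq0 !negb_or => /andP[/andP[q1 q2] qC].
rewrite E1 // E2 // -EC; field.
by rewrite q1 q2 qC.
Qed.

End Rational.

(** * Fitted tables built along a decomposition *)

Section Fit.
Context (V : finType) (e : rel V) (I : V -> finType) (R : realType).
Implicit Types (C W S : {set V}) (j k : state I) (u : counts I).
Implicit Types (b : {set V} -> state I -> R).
Implicit Types (c : {set V} -> state I -> nat).

Definition natr_family c : {set V} -> state I -> R := fun C j => (c C j)%:R.

(** The effect on the margins of removing one unit from cell [j]. The truncated subtraction is exact
    for consistent [c] with every [c C j] positive on complete [C]. *)
Definition lower j c : {set V} -> state I -> nat :=
  fun C k => (c C k - eqoff (~: C) k j)%N.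

Lemma natr_family_marginal u :
  natr_family (marginal u) = marginal (fun j => (u j)%:R).
Proof. by apply/funext => C; apply/funext => j; exact: natr_sumout. Qed.

(* [m b] is the expected table on [W] fitted to the complete-set margins [b];
   [Z c] is the sum of [1 / \prod_k (u k)!] over the tables [u] on [W] with
   margins [c]. *)
Record fit W (m : ({set V} -> state I -> R) -> state I -> R) : Prop := Fit {
  fit_dep : forall b, consistent e b -> depends_on W (m b);
  fit_ge0 : forall b j, consistent e b -> 0 <= m b j;
  fit_sum : forall b C j, consistent e b -> complete_set e C -> C \subset W ->
    sumout (W :\: C) (m b) j = b C j;
  fit_log : forall b, consistent e b ->
    (forall C j, complete_set e C -> 0 < b C j) ->
    (forall j, 0 < m b j) /\ in_rowspan e (fun j => ln (m b j));
  fit_cvg : forall (b_ : nat -> {set V} -> state I -> R) b,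
    (forall n, consistent e (b_ n)) -> consistent e b ->
    (forall C j, complete_set e C -> (b_ n C j @[n --> \oo] --> b C j)%classic) ->
    forall j, (m (b_ n) j @[n --> \oo] --> m b j)%classic;
  fit_rat : forall c j, exists q : rat, m (natr_family c) j = ratr q;
  fit_count : exists Z : ({set V} -> state I -> nat) -> R,
    [/\ forall c, 0 < Z c,
        forall c, (forall C j, complete_set e C -> c C j = 0%N) -> Z c = 1 &
        forall c j, consistent e (natr_family c) ->
          (forall C, complete_set e C -> (0 < c C j)%N) ->
          Z (lower j c) = m (natr_family c) j * Z c];
  fit_rational : forall j,
    rational_in_counts (fun u => m (natr_family (marginal u)) j) }.

Lemma fit_le W m b C j : fit W m -> consistent e b -> complete_set e C ->
  C \subset W -> m b j <= b C j.
Proof.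
move=> hm hb cC CW; rewrite -(fit_sum hm j hb cC CW); apply: sumout_ge => k.
exact: fit_ge0 hm _ _ hb.
Qed.

Context (o : state I).

(** Agreement with [o] off [C] selects one representative of each [C]-cell, so every cell
    contributes one factorial. *)
Definition cell_fact C c : R := \prod_(k | eqoff C o k) (c C k)`!%:R.

Lemma cell_fact_gt0 C c : 0 < cell_fact C c.
Proof. by apply: prodr_gt0 => k _; rewrite ltr0n fact_gt0. Qed.

Lemma cell_fact_zero C c : (forall j, c C j = 0%N) -> cell_fact C c = 1.
Proof. by move=> c0; apply: big1 => k _; rewrite c0. Qed.

Lemma cell_fact_lower C c j : depends_on C (c C) -> (0 < c C j)%N ->
  cell_fact C c = (c C j)%:R * cell_fact C (lower j c).
Proof.
move=> hc cj; pose k0 := splice C o j.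
have ok0 : eqoff C o k0 by exact: eqoff_splice.
have jk0 : eqoff (~: C) j k0 by exact: eqoff_spliceC.
rewrite /cell_fact (bigD1 k0) //= [in RHS](bigD1 k0) //= mulrA.
rewrite /lower -(hc _ _ jk0) eqoff_sym jk0; congr (_ * _).
  by case: (c C j) cj => // n _; rewrite subn1 factS natrM.
apply: eq_bigr => k /andP[ok kk0]; case jk: eqoff; rewrite ?subn0 //.
case/eqP: kk0; apply/ffunP => v; rewrite ffunE; case: ifP => vC.
  by have /eqoffP -> := jk; rewrite // inE vC.
by have /eqoffP -> := ok; rewrite // vC.
Qed.

(** A complete set meeting both [V1] and [V2] would contain an edge between them, a walk that avoids
    [S]. *)
Lemma complete_separated (W V1 V2 S C : {set V}) : W = V1 :|: V2 :|: S ->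
  [disjoint V1 & S] -> [disjoint V2 & S] -> [disjoint V1 & V2] ->
  separates e W V1 V2 S -> complete_set e C -> C \subset W ->
  (C \subset V1 :|: S) || (C \subset V2 :|: S).
Proof.
move=> WE d1 d2 d12 sep cC CW; apply/orP.
have [|/subsetPn[x xC]] := boolP (C \subset V1 :|: S); first by left.
rewrite finset.in_setU negb_or => /andP[xV1 xS]; right; apply/fintype.subsetP => y yC.
have xW := fintype.subsetP CW _ xC; have := fintype.subsetP CW _ yC.
have xV2 : x \in V2.
  by move: xW; rewrite WE !finset.in_setU (negbTE xV1) (negbTE xS) orbF.
rewrite WE !finset.in_setU => /orP[/orP[yV1|->//]|->]; rewrite ?orbT //.
have exy : e y x.
  by apply: (complete_setP _ _ cC) => //; apply: contraNneq xV1 => <-.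
have := sep y [:: x] yV1; rewrite /= exy xW => /(_ isT isT xV2).
by rewrite (negbTE xS) (disjointFr d1 yV1).
Qed.

(** Sum out [V2] first: [f1 / g] is constant there and [f2] sums to [g], which leaves [f1]. Where
    [g] vanishes so does [f1], in accordance with [x / 0 = 0]. *)
Lemma sumout_glue (W1 V2 S C : {set V}) (f1 f2 g : state I -> R) j :
  depends_on W1 f1 -> depends_on S g -> S \subset W1 -> C \subset W1 ->
  [disjoint W1 & V2] -> (forall k, sumout V2 f2 k = g k) ->
  (forall k, g k = 0 -> f1 k = 0) ->
  sumout ((W1 :|: V2) :\: C) (fun k => f1 k * f2 k / g k) j = sumout (W1 :\: C) f1 j.
Proof.
move=> h1 hg SW CW d hf fg.
have -> : (W1 :|: V2) :\: C = (W1 :\: C) :|: V2.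
  apply/setP => v; rewrite !inE andb_orr; congr orb.
  case vV: (v \in V2); rewrite ?andbF // andbT.
  apply/negP => /(fintype.subsetP CW) vW.
  by rewrite (disjointFr d vW) in vV.
have W1V2 : W1 \subset ~: V2 by rewrite -finset.disjoints_subset.
rewrite sumoutU; last by apply: disjointWl d; rewrite finset.subsetDl.
apply: eq_sumout => k.
rewrite (@eq_sumout _ _ _ _ _ (fun k => f1 k / g k * f2 k)) => [|l];
  last by rewrite mulrAC.
rewrite sumoutM; last first.
  move=> l l' ll'; rewrite (depends_onS W1V2 h1 ll').
  by rewrite (depends_onS (fintype.subset_trans SW W1V2) hg ll').
rewrite hf; have [gk|gk] := eqVneq (g k) 0; first by rewrite (fg _ gk) !mul0r.
by rewrite divfK.
Qed.

Lemma fit_complete W : complete_set e W -> fit W (fun b => b W).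
Proof.
move=> cW; split.
- by move=> b hb; apply: consistent_dep hb _ cW.
- by move=> b j hb; apply: consistent_ge0 hb _ _ cW.
- by move=> b C j hb cC CW; apply: consistent_sum hb _ _ _ cW CW.
- move=> b hb b0; split=> [j|]; first exact: b0.
  apply: (in_rowspan_dep cW) => j k jk.
  by rewrite (consistent_dep hb cW jk).
- by move=> b_ b _ _ h j; apply: h.
- by move=> c j; exists (c W j)%:R; rewrite ratr_nat.
- exists (fun c => (cell_fact W c)^-1); split=> [c|c c0|c j hc c0].
  + by rewrite invr_gt0 cell_fact_gt0.
  + by rewrite cell_fact_zero ?invr1 // => j; apply: c0.
  + have dc : depends_on W (c W).
      by move=> k l kl; apply/eqP; rewrite -(eqr_nat R); apply/eqP;
        exact: (consistent_dep hc cW kl).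
    rewrite (cell_fact_lower dc (c0 _ cW)) invfM mulrA divff ?mul1r //.
    by rewrite pnatr_eq0 -lt0n c0.
- exact: rational_marginal.
Qed.

(** The separator margin dominates both fitted tables, so wherever it vanishes the numerator does
    too. For [Z] the separator contributes its factorials as a numerator, whose lowering produces
    the division by [b S j]. *)
Lemma fit_split (W V1 V2 S : {set V}) m1 m2 : W = V1 :|: V2 :|: S ->
  [disjoint V1 & V2] -> [disjoint V1 & S] -> [disjoint V2 & S] ->
  complete_set e S -> separates e W V1 V2 S ->
  fit (V1 :|: S) m1 -> fit (V2 :|: S) m2 ->
  fit W (fun b j => m1 b j * m2 b j / b S j).
Proof.
move=> WE d12 d1 d2 cS sep h1 h2.
have S1 : S \subset V1 :|: S by rewrite finset.subsetUr.
have S2 : S \subset V2 :|: S by rewrite finset.subsetUr.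
have zero1 b k : consistent e b -> b S k = 0 -> m1 b k = 0.
  move=> hb bS; apply/eqP; rewrite eq_le (fit_ge0 h1) // andbT.
  by rewrite -bS (fit_le _ h1).
have zero2 b k : consistent e b -> b S k = 0 -> m2 b k = 0.
  move=> hb bS; apply/eqP; rewrite eq_le (fit_ge0 h2) // andbT.
  by rewrite -bS (fit_le _ h2).
have sum1 b k : consistent e b -> sumout V1 (m1 b) k = b S k.
  move=> hb; rewrite -(fit_sum h1 k hb cS S1); congr (sumout _ _ k).
  apply/setP => v; rewrite !inE; case vS: (v \in S); rewrite ?orbF //=.
  by rewrite (disjointFl d1 vS).
have sum2 b k : consistent e b -> sumout V2 (m2 b) k = b S k.
  move=> hb; rewrite -(fit_sum h2 k hb cS S2); congr (sumout _ _ k).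
  apply/setP => v; rewrite !inE; case vS: (v \in S); rewrite ?orbF //=.
  by rewrite (disjointFl d2 vS).
split.
- move=> b hb j k jk.
  rewrite (depends_onS _ (fit_dep h1 hb) jk).
    rewrite (depends_onS _ (fit_dep h2 hb) jk).
      by rewrite (depends_onS _ (consistent_dep hb cS) jk) // WE finset.subsetUr.
    by rewrite WE finset.setSU // finset.subsetUr.
  by rewrite WE finset.setSU // finset.subsetUl.
- move=> b j hb; have m1b := fit_ge0 h1 j hb; have m2b := fit_ge0 h2 j hb.
  by rewrite !mulr_ge0 // invr_ge0 (consistent_ge0 hb).
- move=> b C j hb cC CW.
  have /orP[C1|C2] := complete_separated WE d1 d2 d12 sep cC CW.
    rewrite -(fit_sum h1 j hb cC C1) WE finset.setUAC.
    apply: (sumout_glue (S := S)) => //.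
    + exact: (fit_dep h1 hb).
    + exact: (consistent_dep hb cS).
    + by rewrite -finset.setI_eq0 finset.setIUl finset.setU_eq0 !finset.setI_eq0
        d12 disjoint_sym.
    + by move=> k; apply: sum2.
    + by move=> k; apply: zero1.
  rewrite -(fit_sum h2 j hb cC C2) WE -finset.setUA finset.setUC.
  rewrite (@eq_sumout _ _ _ _ _ (fun k => m2 b k * m1 b k / b S k)) => [|k];
    last first.
    by rewrite [m1 b k * _]mulrC.
  apply: (sumout_glue (S := S)) => //.
  + exact: (fit_dep h2 hb).
  + exact: (consistent_dep hb cS).
  + by rewrite -finset.setI_eq0 finset.setIUl finset.setU_eq0 !finset.setI_eq0
      disjoint_sym d12 disjoint_sym.
  + by move=> k; apply: sum1.
  + by move=> k; apply: zero2.
- move=> b hb b0; have [p1 r1] := fit_log h1 hb b0; have [p2 r2] := fit_log h2 hb b0.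
  split=> [j|]; first by rewrite divr_gt0 ?mulr_gt0 ?b0.
  have rS : in_rowspan e (fun j => ln (b S j)).
    by apply: (in_rowspan_dep cS) => j k jk; rewrite (consistent_dep hb cS jk).
  have [t ht] := in_rowspanD (in_rowspanD r1 r2) (in_rowspanN rS).
  exists t => j; rewrite -ht !lnM ?lnV ?posrE ?invr_gt0 ?mulr_gt0 //; exact: b0.
- move=> b_ b hb_ hb h j.
  have c1 : (m1 (b_ n) j @[n --> \oo] --> m1 b j)%classic.
    exact: (fit_cvg h1 hb_ hb h).
  have c2 : (m2 (b_ n) j @[n --> \oo] --> m2 b j)%classic.
    exact: (fit_cvg h2 hb_ hb h).
  have [bS|bS] := eqVneq (b S j) 0; last first.
    by apply: cvgM; [exact: cvgM|apply: cvgV => //; exact: h].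
  (* Where the limiting separator margin is 0, the quotient is squeezed between 0 and [m2 (b_ n) j],
     because [m1 (b_ n) j <= b_ n S j]. *)
  rewrite bS invr0 mulr0; rewrite (zero2 _ _ hb bS) in c2.
  apply: (squeeze_cvgr _ (cvg_cst 0) c2).
  near=> n; have m2n := fit_ge0 h2 j (hb_ n); have m1n := fit_ge0 h1 j (hb_ n).
  have bn := consistent_ge0 (hb_ n) j cS.
  rewrite divr_ge0 ?mulr_ge0 //= mulrAC ler_piMl //.
  have [->|bn0] := eqVneq (b_ n S j) 0; first by rewrite invr0 mulr0 ler01.
  by rewrite ler_pdivrMr ?lt_def ?bn0 // mul1r (fit_le _ h1).
- move=> c j; have [q1 e1] := fit_rat h1 c j; have [q2 e2] := fit_rat h2 c j.
  exists (q1 * q2 / (c S j)%:R); by rewrite e1 e2 fmorph_div rmorphM /= ratr_nat.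
- have [Z1 [p1 z1 l1]] := fit_count h1; have [Z2 [p2 z2 l2]] := fit_count h2.
  exists (fun c => Z1 c * Z2 c * cell_fact S c); split=> [c|c c0|c j hc c0].
  + by rewrite !mulr_gt0 ?cell_fact_gt0.
  + by rewrite z1 // z2 // cell_fact_zero ?mulr1 // => j; apply: c0.
  + have dc : depends_on S (c S).
      by move=> k l kl; apply/eqP; rewrite -(eqr_nat R); apply/eqP;
        exact: (consistent_dep hc cS kl).
    rewrite l1 // l2 // (cell_fact_lower dc (c0 _ cS)) /natr_family.
    have : (c S j)%:R != 0 :> R by rewrite pnatr_eq0 -lt0n c0.
    move: (c S j)%:R => x x0; field.
    exact: x0.
- move=> j; apply: rational_glue; first exact: (fit_rational h1).
  exact: (fit_rational h2).
Unshelve. all: by end_near.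
Qed.

Lemma decomposable_fit W : decomposable e W -> exists m, fit W m.
Proof.
elim=> [{}W cW|{}W V1 V2 S WE d12 d1 d2 _ _ cS sep _ [m1 h1] _ [m2 h2]].
  by eexists; exact: fit_complete.
by eexists; exact: fit_split WE d12 d1 d2 cS sep h1 h2.
Qed.

End Fit.

(** * Both estimators equal the fitted table *)

(* Equality case of [ln x <= x - 1], for [x = p j / (w j / N)]. *)
Lemma gibbs_eq (R : realType) (J : finType) (w : J -> nat) (p : J -> R)
    (N := (\sum_j w j)%N) : (0 < N)%N -> (forall j, 0 <= p j) -> \sum_j p j = 1 ->
  \prod_j ((w j)%:R / N%:R) ^+ w j <= \prod_j p j ^+ w j ->
  forall j, p j = (w j)%:R / N%:R.
Proof.
move=> N_gt0 p0 p1 le_wp.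
have N0 : 0 < N%:R :> R by rewrite ltr0n.
(* A zero of [p] in the support of [w] would make the right-hand product 0, while the left-hand one
   is positive. *)
have p_gt0 j : (0 < w j)%N -> 0 < p j.
  move=> wj; rewrite lt_def p0 andbT; apply: contraTneq le_wp => pj.
  rewrite -ltNge [X in X < _](bigD1 j) //= pj expr0n gtn_eqF // mul0r.
  apply: prodr_gt0 => k _; case: (posnP (w k)) => [->|wk]; first by rewrite expr0.
  by rewrite exprn_gt0 // divr_gt0 ?ltr0n.
pose x j := p j * N%:R / (w j)%:R.
have x_gt0 j : (0 < w j)%N -> 0 < x j.
  by move=> wj; rewrite divr_gt0 ?mulr_gt0 ?p_gt0 ?ltr0n.
have ln_ge0 : 0 <= \sum_j (w j)%:R * ln (x j).
  rewrite -ler_expR expR0 expR_sum.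
  have pE j : p j ^+ w j = ((w j)%:R / N%:R) ^+ w j * expR ((w j)%:R * ln (x j)).
    case: (posnP (w j)) => [->|wj]; first by rewrite !expr0 mul0r expR0 mulr1.
    rewrite [(w j)%:R * ln _]mulrC expRM_natr lnK ?posrE ?x_gt0 // -exprMn.
    congr (_ ^+ _).
    have cancel (a b c : R) : a != 0 -> b != 0 -> c = a / b * (c * b / a).
      by move=> a0 b0; field; rewrite a0 b0.
    by rewrite -cancel // ?gt_eqF // ltr0n.
  move: le_wp; under [X in _ <= X]eq_bigr do rewrite pE.
  rewrite big_split /= ler_pMr //.
  apply: prodr_gt0 => k _; case: (posnP (w k)) => [->|wk]; first by rewrite expr0.
  by rewrite exprn_gt0 // divr_gt0 ?ltr0n.
have term_ge0 j : 0 <= (w j)%:R * (x j - 1 - ln (x j)).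
  case: (posnP (w j)) => [->|wj]; first by rewrite mul0r.
  have x0 := x_gt0 j wj; rewrite mulr_ge0 //.
  have := expR_ge1Dx (ln (x j)); rewrite lnK ?posrE //.
  by move=> ?; lra.
have wx_le j : (w j)%:R * x j <= p j * N%:R.
  case: (posnP (w j)) => [->|wj]; first by rewrite mul0r mulr_ge0 ?p0 // ltW.
  by rewrite /x mulrC divfK // pnatr_eq0 -lt0n.
have sum_le0 : \sum_j (w j)%:R * (x j - 1 - ln (x j)) <= 0.
  have -> : \sum_j (w j)%:R * (x j - 1 - ln (x j)) =
      \sum_j (w j)%:R * x j - N%:R - \sum_j (w j)%:R * ln (x j).
    rewrite natr_sum -!sumrB; apply: eq_bigr => j _; ring.
  have : \sum_j (w j)%:R * x j <= N%:R.
    have -> : N%:R = \sum_j p j * N%:R by rewrite -mulr_suml p1 mul1r.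
    by apply: ler_sum => j _; exact: wx_le.
  lra.
have x1 j : (0 < w j)%N -> x j = 1.
  move=> wj; apply/eqP/contraT => xj.
  have lnx : ln (x j) != 0 by rewrite ln_eq0 // x_gt0.
  have : \sum_j (w j)%:R * (x j - 1 - ln (x j)) == 0.
    by rewrite eq_le sum_le0 sumr_ge0.
  rewrite psumr_eq0 // => /allP/(_ j); rewrite mem_index_enum => /(_ isT) /=.
  rewrite mulf_eq0 pnatr_eq0 (gtn_eqF wj) /= => /eqP h.
  have := expR_gt1Dx lnx; rewrite lnK ?posrE ?x_gt0 //.
  by move=> ?; exfalso; lra.
(* Now [p] dominates [w / N] everywhere, trivially off the support of [w]; both sum to 1, so they
   are equal. *)
have le_p j : (w j)%:R / N%:R <= p j.
  case: (posnP (w j)) => [->|wj]; first by rewrite mul0r.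
  have wj0 : (w j)%:R != 0 :> R by rewrite pnatr_eq0 -lt0n.
  by rewrite ler_pdivrMr // -(divfK wj0 (_ * _)) -/(x j) x1 // mul1r.
have : \sum_j (p j - (w j)%:R / N%:R) == 0.
  by rewrite sumrB p1 -mulr_suml -natr_sum divff ?subrr // pnatr_eq0 -lt0n.
rewrite psumr_eq0 => [/allP h j|j _]; last by rewrite subr_ge0.
by apply/eqP; rewrite -subr_eq0; apply: h; rewrite mem_index_enum.
Qed.

(** Clearing denominators turns a rational table into counts, the form in which the binomial
    equations apply. *)
Lemma rat_common_denom (R : realType) (J : finType) (f : J -> R) :
  (forall j, 0 <= f j) -> (forall j, exists q : rat, f j = ratr q) ->
  exists2 d : nat, (0 < d)%N & forall j, exists w : nat, d%:R * f j = w%:R.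
Proof.
move=> f0 /choice[q hq].
exists (\prod_j `|denq (q j)|)%N => [|j].
  by apply: prodn_gt0 => j; rewrite absz_gt0 denq_neq0.
exists (`|numq (q j)| * \prod_(k | k != j) `|denq (q k)|)%N.
have q0 : 0 <= q j by rewrite -(ler0q R) -hq.
rewrite (bigD1 j) //= !natrM mulrAC; congr (_ * _).
rewrite !natr_absz !ger0_norm ?numq_ge0 ?denq_ge0 //.
by rewrite hq /ratr mulrC divfK // intr_eq0 denq_neq0.
Qed.

(** * Identification of both estimators with the fitted table *)

Section Estimators.
Context (V : finType) (e : rel V) (I : V -> finType) (R : realType).
Context (o : state I) (m : ({set V} -> state I -> R) -> state I -> R).
Hypothesis hm : fit e [set: V] m.
Implicit Types (C W S : {set V}) (j k : state I) (u : counts I).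
Implicit Types (c : {set V} -> state I -> nat).

Local Notation natr_family := (natr_family R).

Lemma fit_total (b : {set V} -> state I -> R) j : consistent e b ->
  \sum_k m b k = b finset.set0 j.
Proof.
move=> hb; rewrite -(fit_sum hm j hb (complete_set0 e) (finset.sub0set _)).
by rewrite finset.setD0 sumoutT.
Qed.

Definition has_margins c u : bool :=
  [forall C : {set V}, complete_set e C ==> [forall j, marginal u C j == c C j]].

Lemma has_marginsP c u :
  reflect (forall C j, complete_set e C -> marginal u C j = c C j) (has_margins c u).
Proof.
apply: (iffP forallP) => [h C j cC|h C].
  by have /implyP/(_ cC)/forallP/(_ j)/eqP := h C.
by apply/implyP => cC; apply/forallP => j; apply/eqP/h.
Qed.

Lemma marginal_delta C j k :
  marginal (fun l => (l == j) : nat) C k = eqoff (~: C) k j.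
Proof.
rewrite /marginal /sumout; case kj: eqoff.
  by rewrite (bigD1 j) //= eqxx big1 // => l /andP[_ /negbTE ->].
rewrite big1 // => l kl; case: eqP => // lj.
by rewrite -lj kl in kj.
Qed.

(** On complete sets the lowered family is the difference of two consistent families; positivity of
    [c C j] keeps the truncated subtraction exact. *)
Lemma lower_consistent j c : consistent e (natr_family c) ->
  (forall C, complete_set e C -> (0 < c C j)%N) ->
  consistent e (natr_family (lower j c)).
Proof.
move=> hc c0; have hd := @marginal_nat_consistent V I e R (fun l => (l == j) : nat).
have dep C k l : complete_set e C -> eqoff (~: C) k l -> c C k = c C l.
  by move=> cC kl; apply/eqP; rewrite -(eqr_nat R); apply/eqP;
    exact: (consistent_dep hc cC kl).
have lowerE C k : complete_set e C -> natr_family (lower j c) C k =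
    natr_family c C k - (marginal (fun l => (l == j) : nat) C k)%:R.
  move=> cC; rewrite /natr_family /lower marginal_delta natrB //.
  by case kj: eqoff => //=; rewrite (dep C k j) // c0.
split=> [C cC k l kl|C k cC|C C' k cC CC'].
- by rewrite !lowerE // (consistent_dep hc cC kl) (consistent_dep hd cC kl).
- exact: ler0n.
- rewrite lowerE ?(complete_setS CC') //.
  rewrite -(consistent_sum hc k cC CC') -(consistent_sum hd k cC CC') -sumrB.
  by apply: eq_bigr => l _; rewrite lowerE.
Qed.

(** Induction on [n] over all consistent families, since a lowered family is not known in advance to
    come from a table. Both sides obey the recursion that removes one unit from each cell in
    turn. *)
Lemma sum_invfact_fiber (Z : ({set V} -> state I -> nat) -> R) :
  (forall c, (forall C j, complete_set e C -> c C j = 0%N) -> Z c = 1) ->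
  (forall c j, consistent e (natr_family c) ->
     (forall C, complete_set e C -> (0 < c C j)%N) ->
     Z (lower j c) = m (natr_family c) j * Z c) ->
  forall n c, consistent e (natr_family c) -> (forall j, c finset.set0 j = n) ->
    \sum_(u <- counts_of I n | has_margins c u) invfact R u = Z c /\
    forall j, \sum_(u <- counts_of I n | has_margins c u) (u j)%:R * invfact R u =
              m (natr_family c) j * Z c.
Proof.
move=> Z0 Zlower; have c0E := complete_set0 e.
have m0 c j C : consistent e (natr_family c) -> complete_set e C -> c C j = 0%N ->
    m (natr_family c) j = 0.
  move=> hc cC cj; apply/eqP; rewrite eq_le (fit_ge0 hm) // andbT.
  have := fit_le j hm hc cC (finset.subsetT _); by rewrite /natr_family cj.
elim=> [|n IH] c hc cn.
  have cz C j : complete_set e C -> c C j = 0%N.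
    move=> cC; apply/eqP; rewrite -leqn0 -(cn j) -(ler_nat R).
    exact: (consistent_le j hc cC (finset.sub0set _)).
  split.
    rewrite Z0 //; under eq_bigr do rewrite -[invfact _ _]mulr1.
    rewrite (@sum_counts0 _ _ _ _ (fun=> 1)) //.
    apply/has_marginsP => C j cC; rewrite cz // /marginal /sumout big1 // => k _.
    by rewrite ffunE.
  move=> j; rewrite (m0 _ _ finset.set0) ?cz // mul0r big_seq_cond big1 // => u.
  rewrite mem_counts_of => /andP[/eqP u0 _].
  by have := count_le_total u j; rewrite u0 leqn0 => /eqP ->; rewrite mul0r.
have step j : \sum_(u <- counts_of I n | has_margins c (incr j u)) invfact R u =
    m (natr_family c) j * Z c.
  have [pos|/existsNP[C /not_implyP[cC /negP]]] :=
      pselect (forall C, complete_set e C -> (0 < c C j)%N).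
    rewrite -Zlower //.
    have [|<- _] := IH _ (lower_consistent hc pos).
      by move=> k; rewrite /lower cn finset.setC0 eqoffT subn1.
    apply: eq_bigl => u; apply/has_marginsP/has_marginsP => h C k cC.
      by rewrite /lower -h // marginal_incr addnK.
    rewrite marginal_incr h // /lower subnK //.
    case kj: eqoff => //=.
    have -> : c C k = c C j; last exact: pos.
    by apply/eqP; rewrite -(eqr_nat R); apply/eqP; exact: (consistent_dep hc cC kj).
  (* If a margin vanishes at [j], no table with these margins has a unit in cell [j], and the fitted
     value there is 0 as well. *)
  rewrite -eqn0Ngt => /eqP cj; rewrite (m0 _ _ C) // mul0r big1 // => u.
  move/has_marginsP/(_ C j cC).
  by rewrite marginal_incr eqoff_refl cj addn1.
have shift j :
    \sum_(u <- counts_of I n.+1 | has_margins c u) (u j)%:R * invfact R u =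
    m (natr_family c) j * Z c.
  rewrite -step; under eq_bigr do rewrite -[_ * _]mulr1.
  by rewrite sum_counts_shift; apply: eq_bigr => u _; rewrite mulr1.
split=> //.
(* After multiplication by the total, the recursion applies, and the fitted values sum to [n.+1]. *)
apply: (@mulfI _ n.+1%:R); first by rewrite pnatr_eq0.
under eq_bigr do rewrite -[invfact _ _]mulr1.
rewrite sum_counts_rec.
under eq_bigr => j _ do (under eq_bigr do rewrite mulr1; rewrite step).
rewrite -mulr_suml; congr (_ * _).
by rewrite (fit_total o hc) /natr_family cn.
Qed.

Lemma suffstat_has_margins u u0 :
  (suffstat e u == suffstat e u0) = has_margins (marginal u0) u.
Proof.
apply/eqP/has_marginsP => [/suffstat_marginal h C j cC|h]; first exact: h.
exact/suffstat_marginal.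
Qed.

Lemma marginal0 u j : marginal u finset.set0 j = total_count u.
Proof. by rewrite /marginal finset.setC0 sumoutT. Qed.

(** Both sums in the fibre identity are multiples of the positive number [Z], which cancels. *)
Lemma unbiased_eq_fit (T : {ffun marginal_cell e I -> nat} -> state I -> R) u j :
  (forall n, unbiased e n j (fun u => T (suffstat e u) j)) ->
  T (suffstat e u) j = m (natr_family (marginal u)) j.
Proof.
move=> /(unbiased_fiber u); have [Z [Z_gt0 Z0 Zlower]] := fit_count hm.
have hc : consistent e (natr_family (marginal u)) by exact: marginal_nat_consistent.
have [S1 S2] := sum_invfact_fiber Z0 Zlower hc (marginal0 u).
under eq_bigl do rewrite suffstat_has_margins; rewrite S1.
under eq_bigl do rewrite suffstat_has_margins; rewrite S2.
by apply: mulIf; rewrite gt_eqF.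
Qed.

(** Adding [harmonic n] to every cell makes all margins positive. The normalised fitted tables of
    the perturbed data lie in the open model and converge to that of [u]. *)
Lemma fit_in_model u j0 : (0 < total_count u)%N ->
  model e (fun j => m (natr_family (marginal u)) j / (total_count u)%:R).
Proof.
move=> n0; pose f n j : R := (u j)%:R + harmonic n.
pose b n := marginal (f n).
have hf n j : 0 < f n j by rewrite ltr_wpDl ?ler0n // harmonic_gt0.
have hb n : consistent e (b n) by apply: marginal_consistent => j; apply/ltW.
have hc : consistent e (natr_family (marginal u)) by exact: marginal_nat_consistent.
have b_gt0 n C j : 0 < b n C j.
  by apply: lt_le_trans (hf n j) _; apply: sumout_ge => k; apply/ltW.
have b_cvg C j : (b n C j @[n --> \oo] --> natr_family (marginal u) C j)%classic.
  rewrite natr_family_marginal /b /marginal /sumout.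
  apply: (@cvg_big R (state I) +%R 0 _ _ _ _ _ _); first exact: add_continuous.
  move=> k _; rewrite -[X in (_ --> X)%classic]addr0.
  by apply: cvgD; [exact: cvg_cst|exact: cvg_harmonic].
apply: (@model_cvg _ _ _ _ (fun n j => m (b n) j / b n finset.set0 j0)) => [n|j].
  have [m0 [t ht]] := fit_log hm (hb n) (fun C j _ => b_gt0 n C j).
  have sumE : b n finset.set0 j0 = \sum_j expR (ln (m (b n) j)).
    rewrite -(fit_total j0 (hb n)); apply: eq_bigr => j _.
    by rewrite lnK ?posrE.
  have -> : (fun j => m (b n) j / b n finset.set0 j0) =
      (fun j => expR (ln (m (b n) j)) / \sum_k expR (ln (m (b n) k))).
    by apply/funext => j; rewrite -sumE lnK ?posrE.
  by apply: open_model_norm; [exists t|rewrite -sumE].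
apply: cvgM; first exact: (fit_cvg hm hb hc (fun C j _ => b_cvg C j)).
apply: cvgV; first by rewrite pnatr_eq0 -lt0n.
rewrite -(marginal0 u j0); exact: b_cvg.
Qed.

(** Over a common denominator [d] the fitted table becomes an integer table [w] with the sufficient
    statistics of [d * u]. On the model the [d]-th power of the likelihood is then the monomial with
    exponent [w], so Gibbs' inequality applies to any maximizer. *)
Lemma mle_eq_fit (M : {ffun marginal_cell e I -> nat} -> state I -> R) u j :
  is_mle M -> M (suffstat e u) j = m (natr_family (marginal u)) j.
Proof.
move=> hM; have [p [pmod pmax] ->] := hM u.
set c := natr_family (marginal u).
have hc : consistent e c by exact: marginal_nat_consistent.
have m_ge0 k : 0 <= m c k by exact: (fit_ge0 hm).
have sum_m : \sum_k m c k = (total_count u)%:R.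
  by rewrite (fit_total o hc) /c /natr_family marginal0.
(* For the empty table both sides are 0, whichever maximizer was chosen. *)
have [n0|n_gt0] := posnP (total_count u).
  rewrite n0 mul0r; apply/esym/eqP; rewrite eq_le m_ge0 andbT.
  by rewrite -(mulr0n 1) -n0 -sum_m (bigD1 j) //= lerDl sumr_ge0.
have n_neq0 : (total_count u)%:R != 0 :> R by rewrite pnatr_eq0 -lt0n.
have [d d_gt0 /choice[w hw]] := rat_common_denom m_ge0 (fit_rat hm (marginal u)).
pose w' : counts I := [ffun k => w k].
pose du : counts I := [ffun k => (d * u k)%N].
have suff_w : suffstat e du = suffstat e w'.
  apply/suffstat_marginal => C k cC; apply/eqP; rewrite -(eqr_nat R); apply/eqP.
  rewrite /marginal !natr_sumout.
  rewrite (@eq_sumout _ _ _ _ _ (fun l => d%:R * (u l)%:R)) => [|l]; last first.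
    by rewrite ffunE natrM.
  rewrite (@eq_sumout _ _ _ _ (fun l => (w' l)%:R) (fun l => d%:R * m c l))
    => [|l]; last first.
    by rewrite ffunE hw.
  rewrite /sumout -!mulr_sumr; congr (_ * _).
  have := fit_sum hm k hc cC (finset.subsetT _).
  by rewrite finset.setTD /sumout => ->; rewrite /c /natr_family natr_sumout.
have sum_w : (\sum_k w k)%:R = d%:R * (total_count u)%:R :> R.
  by rewrite natr_sum -sum_m mulr_sumr; apply: eq_bigr => k _; rewrite hw.
have q_eq k : m c k / (total_count u)%:R = (w k)%:R / (\sum_k w k)%:R.
  by rewrite sum_w -hw -mulf_div divff ?mul1r // pnatr_eq0 -lt0n.
have qmod := fit_in_model o n_gt0; rewrite -/c in qmod.
have pow (r : state I -> R) : \prod_k r k ^+ du k = likelihood u r ^+ d.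
  by rewrite /likelihood -prodrXl; apply: eq_bigr => k _; rewrite ffunE mulnC exprM.
have le_wp : \prod_k ((w k)%:R / (\sum_k w k)%:R) ^+ w k <= \prod_k p k ^+ w k :> R.
  have wE (r : state I -> R) : model e r -> \prod_k r k ^+ w k = likelihood u r ^+ d.
    move=> rmod; rewrite -pow (model_monomial suff_w rmod).
    by apply: eq_bigr => k _; rewrite ffunE.
  under eq_bigr do rewrite -q_eq.
  rewrite !wE //; apply: lerXn2r; last exact: pmax.
    by apply: prodr_ge0 => k _; rewrite exprn_ge0 // divr_ge0.
  by apply: prodr_ge0 => k _; rewrite exprn_ge0 // (model_ge0 _ pmod).
suff -> : p j = m c j / (total_count u)%:R by rewrite mulrC divfK.
rewrite q_eq; apply: (gibbs_eq _ _ (model_sum pmod) le_wp) => [|k].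
  by rewrite -(ltr_nat R) sum_w mulr_gt0 ?ltr0n.
exact: (model_ge0 k pmod).
Qed.

End Estimators.

Theorem theorem2p9 (R : realType) (V : finType) (e : rel V)
    (e_sym : symmetric e) (e_irr : irreflexive e)
    (I : V -> finType) (I_ge2 : forall v : V, (2 <= #|I v|)%N)
    (T M : {ffun marginal_cell e I -> nat} -> state I -> R)
    (T_umvue : is_umvue T) (M_mle : is_mle M) :
  ((forall b, range (@suffstat V e I) b -> forall j, T b j = M b j)
     <-> decomposable e [set: V])
  /\ (decomposable e [set: V] ->
      forall j, rational_in_counts (fun u => M (suffstat e u) j)).
Proof.
have T_unb n j : unbiased e n j (fun u => T (suffstat e u) j) by case: (T_umvue n j).
(* Two distinct values of each variable provide the levels of the cube; the first ones form the
   reference state [o]. *)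
have [alpha alpha_neq] : exists alpha : forall v, I v * I v,
    forall v, (alpha v).1 != (alpha v).2.
  have pair v : exists a : I v * I v, a.1 != a.2.
    by have /card_gt1P[x [y [_ _ xy]]] := I_ge2 v; exists (x, y).
  by exists (fun v => xchoose (pair v)) => v; exact: xchooseP (pair v).
pose o : state I := [ffun v => (alpha v).1].
split; first split.
- move=> TM; have [//|[a [s [t [D cyc]]]]] := decomposable_or_chordless e_sym [set: V].
  case: (chordless_umvue_neq_mle e_sym e_irr alpha_neq cyc T_unb M_mle) => u j.
  by apply: TM; exists u.
- move=> /(decomposable_fit R o)[m hm] _ [u _ <-] j.
  by rewrite (unbiased_eq_fit o hm) // (mle_eq_fit o hm).
- move=> /(decomposable_fit R o)[m hm] j.
  have [P [Q [Q_neq0 E]]] := fit_rational hm j; exists P, Q; split=> // u.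
  by rewrite (mle_eq_fit o hm) //; exact: E.
Qed.
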